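(* Let $N\ge2$, $R\ge0$, and let $\Sigma=\mathbb{R}^N$ if $R=0$ and $\Sigma=\{x\in\mathbb{R}^N:|x|>R\}$ if $R>0$. Put $I:=[R,\infty)$ and let $f:[0,\infty)\times I\times\mathbb{R}\to\mathbb{R}$, $(t,r,u)\mapsto f(t,r,u)$, satisfy the following. (i) For every $r>0$ there is $K_r>0$ such that $\sup_{s\in[R,r],\,t>0}|f(t,s,0)|<K_r$. (ii) $f$ is continuous in $t$ and $r$, continuously differentiable in $u$, and $$\lim_{u\to v}\sup_{r\in I,\,t>0}|f_u(t,r,u)-f_u(t,r,v)|=0\quad\text{for every } v\in\mathbb{R},$$ $$\sup_{r\in J,\,t>0,\,s\in[-K,K]}|f_u(t,r,s)|<\infty\quad\text{for every } K>0\text{ and every } J\subset I \text{ with } \overline J \text{ a compact subset of } I.$$ (iii) There are constants $\rho,\gamma,\varepsilon>0$ such that $f_u(t,|x|,s)<-\gamma$ for all $|x|>\rho$ (with $x\in\Sigma$), $t\ge0$, and $s\in(-\varepsilon,\varepsilon)$. Let $u\in C^{2,1}(\Sigma\times(0,\infty))\cap C(\overline\Sigma\times[0,\infty))$ be a classical bounded solution, periodic in time, of $$u_t-\Delta u=f(t,|x|,u)\ \text{ in }\Sigma\times(0,\infty),\qquad u=0\ \text{ on }\partial\Sigma\times(0,\infty),\qquad u(x,0)=u_0(x)\ \text{ for } x\in\Sigma,$$ such that $u_0\in C_0(\overline\Sigma)$, there is $e\in\mathbb{S}^{N-1}$ with $u_0(x)\ge u_0(\sigma_e(x))$ for all $x\in\Sigma(e)$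 and $u_0\not\equiv u_0\circ\sigma_e$, and $\lim_{|x|\to\infty}u(x,t)=0$ for $t\ge0$. Then there exists $p\in\mathbb{S}^{N-1}$ such that, for all $t\ge0$, $u(\cdot,t)$ is foliated Schwarz symmetric with respect to $p$ and strictly decreasing in the polar angle.
   Context: $\mathbb{S}^{N-1}=\{x\in\mathbb{R}^N:|x|=1\}$. For $e\in\mathbb{S}^{N-1}$: $\Sigma(e):=\{x\in\Sigma:x\cdot e>0\}$ and $\sigma_e(x):=x-2(x\cdot e)e$. If $R=0$, $\partial\Sigma=\emptyset$ and there is no boundary condition. $C_0(\overline\Sigma)$ is the space of continuous functions on $\overline\Sigma$ which decay to zero at infinity and vanish on $\partial\Sigma$. Periodic in time means that there is $T>0$ with $u(x,t+T)=u(x,t)$ for all $x\in\Sigma$, $t\ge0$. A function $z\in C(\Sigma)$ is foliated Schwarz symmetric with respect to $p\in\mathbb{S}^{N-1}$ if $z$ is axially symmetric with respect to the axis $\mathbb{R}p$ and nonincreasing in the polar angle $\theta=\arccos\left(\frac{x}{|x|}\cdot p\right)\in[0,\pi]$. *)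

(* Defs.v *)
From HB Require Import structures.
From mathcomp Require Export all_boot all_order all_algebra.
From mathcomp Require Export all_classical all_reals all_analysis.

Set Implicit Arguments.
Unset Strict Implicit.
Unset Printing Implicit Defensive.

Export Order.TTheory GRing.Theory Num.Theory.
Export numFieldNormedType.Exports.

Global Open Scope ring_scope.
Global Open Scope classical_set_scope.

(* The library norm [`|x|] on ['rV[R]_N] is the sup norm; it induces the usual
   topology, so it is only used through continuity, closure and differentiation.
   All metric notions of R^N below go through [dotv] and [enorm]. *)
Definition dotv (R : realType) (N : nat) (x y : 'rV[R]_N) : R :=
  \sum_(i < N) x 0 i * y 0 i.

Definition enorm (R : realType) (N : nat) (x : 'rV[R]_N) : R :=
  Num.sqrt (dotv x x).

Definition esphere (R : realType) (N : nat) : set 'rV[R]_N :=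
  [set x | enorm x = 1].
Arguments esphere : clear implicits.

Definition Sigma (R : realType) (N : nat) (rad : R) : set 'rV[R]_N :=
  if rad == 0 then setT else [set x | rad < enorm x].
Arguments Sigma {R} N rad.

Definition boundary (T : topologicalType) (A : set T) : set T :=
  closure A `\` interior A.

Definition half (R : realType) (N : nat) (A : set 'rV[R]_N) (e : 'rV[R]_N) :
  set 'rV[R]_N := [set x | A x /\ 0 < dotv x e].

Definition reflection (R : realType) (N : nat) (e x : 'rV[R]_N) : 'rV[R]_N :=
  x - (2 * dotv x e) *: e.

Definition vanishes_at_infinity (R : realType) (N : nat) (A : set 'rV[R]_N)
    (g : 'rV[R]_N -> R) : Prop :=
  forall eps : R, 0 < eps ->
    exists M : R, forall x, A x -> M < enorm x -> `|g x| < eps.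

(* g belongs to C_0 of the closure of A *)
Definition C0_closure (R : realType) (N : nat) (A : set 'rV[R]_N)
    (g : 'rV[R]_N -> R) : Prop :=
  [/\ {within closure A, continuous g},
      forall x, boundary A x -> g x = 0
    & vanishes_at_infinity (closure A) g].

Definition basis_vec (R : realType) (N : nat) (i : 'I_N) : 'rV[R]_N :=
  delta_mx 0 i.
Arguments basis_vec R {N} i.

Definition partial_x (R : realType) (N : nat) (i : 'I_N)
    (g : 'rV[R]_N -> R) : 'rV[R]_N -> R :=
  fun x => 'D_(basis_vec R i) g x.

Definition laplacian (R : realType) (N : nat) (g : 'rV[R]_N -> R) :
    'rV[R]_N -> R :=
  fun x => \sum_(i < N) partial_x i (partial_x i g) x.

(* u is of class C^{2,1} on A x J (twice in space, once in time), for A and J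
   open; [derivable] is needed since ['D_v] is total. *)
Definition C21 (R : realType) (N : nat) (A : set 'rV[R]_N) (J : set R)
    (u : 'rV[R]_N -> R -> R) : Prop :=
  [/\ {within A `*` J, continuous (fun z : 'rV[R]_N * R => u z.1 z.2)},
      (forall x t, A x -> J t -> derivable (u x) t 1) /\
      {within A `*` J, continuous (fun z : 'rV[R]_N * R => derive1 (u z.1) z.2)},
      (forall i x t, A x -> J t -> derivable (u ^~ t) x (basis_vec R i)) /\
      (forall i, {within A `*` J, continuous
         (fun z : 'rV[R]_N * R => partial_x i (u ^~ z.2) z.1)})
    & (forall i j x t, A x -> J t ->
         derivable (partial_x i (u ^~ t)) x (basis_vec R j)) /\
      (forall i j, {within A `*` J, continuous
         (fun z : 'rV[R]_N * R =>
            partial_x j (partial_x i (u ^~ z.2)) z.1)})].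

Definition polar_angle (R : realType) (N : nat) (p x : 'rV[R]_N) : R :=
  acos (dotv ((enorm x)^-1 *: x) p).

(* Invariance under every linear isometry of R^N fixing the axis R p pointwise.
   All of O(N) is used rather than SO(N), so that for N = 2 this is invariance
   under the reflection across the axis. *)
Definition axially_symmetric (R : realType) (N : nat) (A : set 'rV[R]_N)
    (p : 'rV[R]_N) (z : 'rV[R]_N -> R) : Prop :=
  forall Q : 'M[R]_N, Q *m Q^T = 1%:M -> p *m Q = p ->
    forall x, A x -> z (x *m Q) = z x.

(* The origin, which lies in Sigma when rad = 0, has no polar angle. *)
Definition nonincreasing_in_angle (R : realType) (N : nat)
    (A : set 'rV[R]_N) (p : 'rV[R]_N) (z : 'rV[R]_N -> R) : Prop :=
  forall x y, A x -> A y -> x != 0 -> y != 0 -> enorm x = enorm y ->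
    polar_angle p x <= polar_angle p y -> z y <= z x.

Definition strictly_decreasing_in_angle (R : realType) (N : nat)
    (A : set 'rV[R]_N) (p : 'rV[R]_N) (z : 'rV[R]_N -> R) : Prop :=
  forall x y, A x -> A y -> x != 0 -> y != 0 -> enorm x = enorm y ->
    polar_angle p x < polar_angle p y -> z y < z x.

Definition foliated_Schwarz_symmetric (R : realType) (N : nat)
    (A : set 'rV[R]_N) (p : 'rV[R]_N) (z : 'rV[R]_N -> R) : Prop :=
  [/\ {within A, continuous z},
      axially_symmetric A p z
    & nonincreasing_in_angle A p z].

(* The derivative f_u of (t, r, u) |-> f(t, r, u) in its last argument. *)
Definition partial_u (R : realType) (f : R -> R -> R -> R) (t r : R) : R -> R :=
  derive1 (f t r).

(* Main.v *)
(* Rotating planes. For a normal [e], the gap [W_e x t = u x t - u (refl e x) t]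
   solves a linear parabolic equation on [{x in Sigma | 0 < x . e}] and vanishes
   on its boundary. Let [P] be the set of all [e] with [W_e > 0] there for all
   times. The hypothesis on [u0] and the strong maximum principle give a point
   of [P]; periodicity turns positivity at one time into positivity at all times.

   [P] is open. Near a given element, [W_e] stays positive on a compact core.
   Off the core, a barrier in space handles the neighbourhood of the boundary.
   Far out, the zeroth order coefficient is below [- gamma] as soon as [u] is
   small; since [u] tends to 0 only pointwise in time, this may fail during some
   times, but the measure of these within one period tends to 0 as the radius
   grows. Hence the negative part of [W_e] contracts by a factor [b T < 1] over
   each period, and by periodicity it vanishes.

   Let [p] maximise [u] at time 0 on some sphere in [Sigma]. If positivity
   degenerated at a limit [e] of elements of [P] with [e . p > 0], then [refl e p]
   would be a maximiser as well, on the side where nearby gaps are negative. So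
   [P] contains the half space [e . p > 0], and [W_e = 0] for [e] orthogonal to
   [p]. Comparing two points [x] and [y] of equal norm through [e = x - y] yields
   all the symmetry claims. *)

(* Normals are arbitrary nonzero vectors, so the half space [e . p > 0] is convex and [P] can be
   carried along straight segments inside it. The closedness step is where a Hopf lemma or unique
   continuation might be expected; neither is used. If [e] is outside [P] but its gap is
   nonnegative, the strong maximum principle leaves no positive value at time 0, in particular none
   at the maximiser [p]; hence [refl e p] is a second maximiser, and an element of [P] never has a
   maximiser strictly on its negative side. For openness the gap is bounded below by
   [- M b(t) phi(x)], where two gains are balanced: the very negative Laplacian of [phi] near the
   boundary, and the decay of [b] far out. Only a one-sided exponential bound on [b] at each time
   enters, so [b] can be built from the Lebesgue measure of the bad times, with no
   differentiability. The order of choices matters: the radius, [b] and the steepness of [phi]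
   determine the core and are fixed before [e] is taken close to the given normal. *)
Require Import Defs.
From mathcomp Require Import ring lra.

Set Implicit Arguments.
Unset Strict Implicit.
Unset Printing Implicit Defensive.

(** * Euclidean geometry and reflections *)

Section InnerProduct.
Context {R : realType} {N : nat}.
Implicit Types (x y z v e : 'rV[R]_N) (a b h : R).

Lemma dotvC x y : dotv x y = dotv y x.
Proof. by apply: eq_bigr => i _; rewrite mulrC. Qed.

Lemma dotvDl x y z : dotv (x + y) z = dotv x z + dotv y z.
Proof. by rewrite -big_split; apply: eq_bigr => i _; rewrite !mxE mulrDl. Qed.

Lemma dotvZl a x y : dotv (a *: x) y = a * dotv x y.
Proof. by rewrite big_distrr; apply: eq_bigr => i _ /=; rewrite !mxE mulrA. Qed.

Lemma dotvNl x y : dotv (- x) y = - dotv x y.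
Proof. by rewrite -scaleN1r dotvZl mulN1r. Qed.

Lemma dotvBl x y z : dotv (x - y) z = dotv x z - dotv y z.
Proof. by rewrite dotvDl dotvNl. Qed.

Lemma dotvDr x y z : dotv x (y + z) = dotv x y + dotv x z.
Proof. by rewrite dotvC dotvDl !(dotvC x). Qed.

Lemma dotvZr a x y : dotv x (a *: y) = a * dotv x y.
Proof. by rewrite dotvC dotvZl (dotvC x). Qed.

Lemma dotvNr x y : dotv x (- y) = - dotv x y.
Proof. by rewrite dotvC dotvNl (dotvC x). Qed.

Lemma dotvBr x y z : dotv x (y - z) = dotv x y - dotv x z.
Proof. by rewrite dotvDr dotvNr. Qed.

Lemma dotv0l x : dotv 0 x = 0.
Proof. by rewrite -(scale0r 0) dotvZl mul0r. Qed.

Lemma dotv_ge0 x : 0 <= dotv x x.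
Proof. by apply: sumr_ge0 => i _; rewrite -expr2 sqr_ge0. Qed.

Lemma sqr_coord_le_dotv x i : x 0 i ^+ 2 <= dotv x x.
Proof.
rewrite /dotv (bigD1 i) //= -expr2 lerDl sumr_ge0// => j _.
by rewrite -expr2 sqr_ge0.
Qed.

Lemma dotv_eq0 x : (dotv x x == 0) = (x == 0).
Proof.
apply/idP/idP => [/eqP x0|/eqP ->]; last by rewrite dotv0l.
apply/eqP/rowP => i; rewrite mxE; apply/eqP; rewrite -sqrf_eq0.
by rewrite eq_le sqr_ge0 andbT -x0 sqr_coord_le_dotv.
Qed.

Lemma dotv_gt0 x : (0 < dotv x x) = (x != 0).
Proof. by rewrite lt_neqAle dotv_ge0 andbT eq_sym dotv_eq0. Qed.

Lemma enorm_ge0 x : 0 <= enorm x.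
Proof. exact: sqrtr_ge0. Qed.

Lemma sqr_enorm x : enorm x ^+ 2 = dotv x x.
Proof. by rewrite sqr_sqrtr// dotv_ge0. Qed.

Lemma enormZ a x : enorm (a *: x) = `|a| * enorm x.
Proof. by rewrite /enorm dotvZl dotvZr mulrA -expr2 sqrtrM ?sqr_ge0// sqrtr_sqr. Qed.

Lemma enorm_eq_dotv x y : enorm x = enorm y -> dotv x x = dotv y y.
Proof. by rewrite -!sqr_enorm => ->. Qed.

Lemma le_enormP x a : 0 <= a -> (enorm x <= a) = (dotv x x <= a ^+ 2).
Proof. by move=> a0; rewrite -sqr_enorm ler_sqr ?nnegrE ?enorm_ge0. Qed.

Lemma ge_enormP x a : 0 <= a -> (a <= enorm x) = (a ^+ 2 <= dotv x x).
Proof. by move=> a0; rewrite -sqr_enorm ler_sqr ?nnegrE ?enorm_ge0. Qed.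

Lemma enorm_gt0 x : (0 < enorm x) = (x != 0).
Proof. by rewrite sqrtr_gt0 dotv_gt0. Qed.

Lemma coord_le_enorm x i : `|x 0 i| <= enorm x.
Proof.
rewrite -(ler_sqr) ?nnegrE ?normr_ge0 ?enorm_ge0// sqr_enorm.
by rewrite real_normK ?num_real// sqr_coord_le_dotv.
Qed.

(* [`|x|] is the sup norm. *)
Lemma supnorm_le_enorm x : `|x| <= enorm x.
Proof.
rewrite [leLHS]/Num.norm /= mx_normrE; apply/bigmax_leP; split => [|[i j] _ /=].
  exact: enorm_ge0.
by rewrite ord1 coord_le_enorm.
Qed.

Lemma coord_le_supnorm x i : `|x 0 i| <= `|x|.
Proof.
rewrite [leRHS]/Num.norm /= mx_normrE; apply/bigmax_geP; right => /=.
by exists (0, i).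
Qed.

Lemma dotv_unit_le1 x y : dotv x x = 1 -> dotv y y = 1 -> -1 <= dotv x y <= 1.
Proof.
move=> x1 y1; have := dotv_ge0 (x - y); have := dotv_ge0 (x + y).
rewrite !(dotvDl, dotvDr, dotvNl, dotvNr) x1 y1 (dotvC y x) => h1 h2.
by apply/andP; split; lra.
Qed.

Lemma dotv_mxE x y (Q : 'M[R]_N) : Q *m Q^T = 1%:M ->
  dotv (x *m Q) (y *m Q) = dotv x y.
Proof.
move=> QQ.
have dE u v : dotv u v = (u *m v^T) 0 0.
  by rewrite mxE; apply: eq_bigr => i _; rewrite mxE.
by rewrite !dE trmx_mul mulmxA -(mulmxA x) QQ mulmx1.
Qed.

Lemma dotv_basis (i j : 'I_N) : dotv (basis_vec R i) (basis_vec R j) = (i == j)%:R.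
Proof.
rewrite /dotv (bigD1 i)//= big1 => [|k ki].
  by rewrite !mxE !eqxx/= mul1r addr0 eq_sym.
by rewrite !mxE (negbTE ki) andbF mul0r.
Qed.

Lemma dotv_basis1 (i : 'I_N) : dotv (basis_vec R i) (basis_vec R i) = 1.
Proof. by rewrite dotv_basis eqxx. Qed.

Lemma dotv_basisr x (i : 'I_N) : dotv x (basis_vec R i) = x 0 i.
Proof.
rewrite /dotv (bigD1 i)//= big1 => [|k ki].
  by rewrite !mxE !eqxx/= mulr1 addr0.
by rewrite !mxE (negbTE ki) andbF mulr0.
Qed.

Lemma cvg_dotv (T : Type) (F : set_system T) {FF : Filter F}
    (f g : T -> 'rV[R]_N) x y : f @ F --> x -> g @ F --> y ->
  (fun t => dotv (f t) (g t)) @ F --> dotv x y.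
Proof.
move=> fx gy; rewrite /dotv.
apply: cvg_big => [|i _]; first exact: add_continuous.
apply: cvgM.
  exact: (cvg_comp _ _ fx (@coord_continuous _ _ _ 0 i x)).
exact: (cvg_comp _ _ gy (@coord_continuous _ _ _ 0 i y)).
Qed.

Lemma continuous_dotvl e : continuous (fun x => dotv x e).
Proof. by move=> x; apply: (@cvg_dotv _ (nbhs x) _ id); [exact: cvg_id|exact: cvg_cst]. Qed.

Lemma continuous_enorm : continuous (@enorm R N).
Proof.
move=> x; apply: (continuous_comp (f := fun x => dotv x x) (g := Num.sqrt)).
  by apply: (@cvg_dotv _ (nbhs x) _ id id); exact: cvg_id.
exact: sqrt_continuous.
Qed.

Lemma closed_dotv_ge a e : closed [set x | a <= dotv x e].
Proof.
apply: (@preimage_closed _ _ (fun x => dotv x e) [set y | a <= y]).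
  by move=> x _; exact: continuous_dotvl.
exact: closed_ge.
Qed.

Lemma compact_enorm_le a : compact [set x : 'rV[R]_N | enorm x <= a].
Proof.
apply: bounded_closed_compact.
  exists a; split; first exact: num_real.
  by move=> b ab x /= xa; rewrite (le_trans (supnorm_le_enorm x))// (le_trans xa)// ltW.
apply: (@preimage_closed _ _ (@enorm R N) [set y | y <= a]); last exact: closed_le.
by move=> x _; exact: continuous_enorm.
Qed.

Lemma open_enorm_gt a : open [set x : 'rV[R]_N | a < enorm x].
Proof.
apply: (@open_comp _ _ (@enorm R N) [set y | a < y]); last exact: open_gt.
by move=> x _; exact: continuous_enorm.
Qed.

Lemma open_dotv_gt a e : open [set x : 'rV[R]_N | a < dotv x e].
Proof.
apply: (@open_comp _ _ (fun x => dotv x e) [set y | a < y]); last exact: open_gt.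
by move=> x _; exact: continuous_dotvl.
Qed.

End InnerProduct.

(* For unit [e] this is [reflection e]; allowing every non-zero normal makes
   [x - y] usable as a normal and the normals movable along segments. *)
Definition refl (R : realType) (N : nat) (e x : 'rV[R]_N) : 'rV[R]_N :=
  x - (2 * dotv x e / dotv e e) *: e.

Section Reflection.
Context {R : realType} {N : nat}.
Implicit Types (x y z v e : 'rV[R]_N) (a b h : R).

Lemma reflection_refl e x : esphere R N e -> reflection e x = refl e x.
Proof.
by rewrite /esphere /reflection /refl /= -sqr_enorm => ->; rewrite expr1n divr1.
Qed.

Lemma reflN e x : refl (- e) x = refl e x.
Proof.
by rewrite /refl dotvNr dotvNl dotvNr opprK scalerN mulrN mulNr scaleNr !opprK.
Qed.

Lemma refl_line e x v h : refl e (x + h *: v) = refl e x + h *: refl e v.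
Proof.
rewrite /refl dotvDl dotvZl scalerBr scalerA.
rewrite (_ : 2 * _ / _ = 2 * dotv x e / dotv e e + h * (2 * dotv v e / dotv e e)).
  by rewrite scalerDl opprD !addrA; congr (_ + _); rewrite addrAC.
by ring.
Qed.

Lemma dotv_refl e x y : e != 0 -> dotv (refl e x) (refl e y) = dotv x y.
Proof.
rewrite -dotv_eq0 => e0; rewrite /refl !(dotvBl, dotvBr, dotvZl, dotvZr).
by rewrite (dotvC e y); field.
Qed.

Lemma enorm_refl e x : e != 0 -> enorm (refl e x) = enorm x.
Proof. by move=> e0; rewrite /enorm dotv_refl. Qed.

Lemma dotv_refl_normal e x : e != 0 -> dotv (refl e x) e = - dotv x e.
Proof. by rewrite -dotv_eq0 => e0; rewrite /refl dotvBl dotvZl; field. Qed.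

Lemma reflK e x : e != 0 -> refl e (refl e x) = x.
Proof.
move=> e0; rewrite {1}/refl dotv_refl_normal// /refl mulrN mulNr scaleNr opprK.
by rewrite subrK.
Qed.

Lemma refl_fix e x : dotv x e = 0 -> refl e x = x.
Proof. by move=> xe; rewrite /refl xe mulr0 mul0r scale0r subr0. Qed.

Lemma dotv_sub_gt0 x y : enorm x = enorm y -> x != y -> 0 < dotv x (x - y).
Proof.
move=> /enorm_eq_dotv xy; rewrite -subr_eq0 -dotv_gt0.
by rewrite !(dotvBl, dotvBr) xy (dotvC y x) => h; lra.
Qed.

Lemma refl_sub x y : enorm x = enorm y -> x != y -> refl (x - y) x = y.
Proof.
move=> xy /(dotv_sub_gt0 xy); rewrite /refl => d0.
have -> : dotv (x - y) (x - y) = 2 * dotv x (x - y).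
  by move/enorm_eq_dotv: xy => xy; rewrite !(dotvBl, dotvBr) xy (dotvC y x); ring.
by rewrite divff ?mulf_neq0 ?pnatr_eq0 ?gt_eqF// scale1r opprB addrC subrK.
Qed.

(** The matrix of a reflection is symmetric, so the column sum is the inner product of the images of
    two basis vectors, which a reflection preserves. It makes the trace of a Hessian invariant. *)
Lemma refl_basis_sum e (j k : 'I_N) : e != 0 ->
  \sum_(i < N) refl e (basis_vec R i) 0 j * refl e (basis_vec R i) 0 k
  = (j == k)%:R.
Proof.
move=> e0; rewrite -dotv_basis -(dotv_refl _ _ e0) [RHS]/dotv.
have sym i l : refl e (basis_vec R i) 0 l = refl e (basis_vec R l) 0 i.
  rewrite /refl !mxE !(dotvC (basis_vec _ _)) !dotv_basisr /= eq_sym; congr (_ - _).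
  by ring.
by apply: eq_bigr => i _; rewrite !(sym i).
Qed.

Lemma cvg_refl (T : Type) (F : set_system T) {FF : Filter F}
    (f g : T -> 'rV[R]_N) e x : e != 0 -> f @ F --> e -> g @ F --> x ->
  (fun t => refl (f t) (g t)) @ F --> refl e x.
Proof.
rewrite -dotv_eq0 => e0 fe gx; rewrite /refl; apply: cvgB => //.
apply: cvgZ => //; apply: cvgM; last by apply: cvgV => //; exact: cvg_dotv.
by apply: cvgM; [exact: cvg_cst|exact: cvg_dotv].
Qed.

End Reflection.

(** * Second derivatives and the Laplacian *)

Section SecondDerivative.
Context {R : realType}.
Implicit Types (F G : R -> R) (x a b : R).

Lemma is_derive_cvgP (V : normedModType R) (g : V -> R) (p v : V) (l : R) :
  is_derive p v g l <->
  h^-1 * (g (p + h *: v) - g p) @[h --> 0^'] --> l.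
Proof.
have E : (fun h : R => h^-1 *: ((g \o shift p) (h *: v) - g p)) =
         (fun h => h^-1 * (g (p + h *: v) - g p)).
  by apply/funext => h /=; rewrite (addrC p).
split => [[]|gl].
  by rewrite /derivable /derive E => + <-.
have gc : cvg ((fun h : R => h^-1 *: ((g \o shift p) (h *: v) - g p)) @ 0^').
  by rewrite E; apply/cvg_ex; exists l.
by apply: DeriveDef => //; rewrite /derive E; exact/cvg_lim.
Qed.

(** A relation rather than an iterated total derivative: existence on a neighbourhood is part of it,
    so no default value can intervene. *)
Definition is_derive2 F x a := exists F' : R -> R,
  (\forall h \near x, is_derive h (1 : R) F (F' h)) /\ is_derive x 1 F' a.

Lemma is_derive2_near_eq F G x a :
  (\near x, F x = G x) -> is_derive2 F x a -> is_derive2 G x a.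
Proof.
move=> /near_join FG [F' [dF dF']]; exists F'; split => //.
near=> h; apply: (@near_eq_is_derive _ _ _ F); near: h; exact: dF || exact: FG.
Unshelve. all: by end_near. Qed.

Lemma is_derive2D F G x a b : is_derive2 F x a -> is_derive2 G x b ->
  is_derive2 (fun h => F h + G h) x (a + b).
Proof.
move=> [F' [dF dF']] [G' [dG dG']]; exists (fun h => F' h + G' h); split.
  near=> h; apply: is_deriveD; near: h; [exact: dF|exact: dG].
exact: is_deriveD.
Unshelve. all: by end_near. Qed.

Lemma is_derive2Z F x a k : is_derive2 F x a ->
  is_derive2 (fun h => k * F h) x (k * a).
Proof.
move=> [F' [dF dF']]; exists (fun h => k * F' h); split.
  by near=> h; apply: (@is_deriveZ _ _ _ F); near: h; exact: dF.
exact: (@is_deriveZ _ _ _ F').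
Unshelve. all: by end_near. Qed.

Lemma is_derive2_cst k x : is_derive2 (fun=> k) x 0.
Proof.
exists (fun=> 0); split; last exact: is_derive_cst.
by near=> h; exact: is_derive_cst.
Unshelve. all: by end_near. Qed.

Lemma is_derive_funM F G x a b : is_derive x 1 F a -> is_derive x 1 G b ->
  is_derive x 1 (fun h => F h * G h) (F x * b + G x * a).
Proof. exact: is_deriveM. Qed.

Lemma is_derive_quadratic (a0 b0 c0 x : R) :
  is_derive x 1 (fun h => a0 + b0 * h + c0 * h ^+ 2) (b0 + 2 * c0 * x).
Proof.
have d1 : is_derive x 1 (fun h : R => h) 1 := is_derive_id _ _.
have dc k : is_derive x 1 (fun=> k : R) 0 := is_derive_cst _ _ _.
have d2 := is_derive_funM (dc c0) (is_derive_funM d1 d1).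
apply: (is_derive_eq (is_deriveD (is_deriveD (dc a0) (is_derive_funM (dc b0) d1)) d2)).
ring.
Qed.

Lemma is_derive_affine (a0 b0 x : R) : is_derive x 1 (fun h => a0 + b0 * h) b0.
Proof.
have d1 : is_derive x 1 (fun h : R => h) 1 := is_derive_id _ _.
have dc k : is_derive x 1 (fun=> k : R) 0 := is_derive_cst _ _ _.
apply: (is_derive_eq (is_deriveD (dc a0) (is_derive_funM (dc b0) d1))).
ring.
Qed.

Lemma is_derive2_quadratic (a0 b0 c0 : R) :
  is_derive2 (fun h => a0 + b0 * h + c0 * h ^+ 2) 0 (2 * c0).
Proof.
exists (fun h => b0 + 2 * c0 * h); split; last exact: is_derive_affine.
by near=> h; exact: is_derive_quadratic.
Unshelve. all: by end_near. Qed.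

Lemma is_derive2_expR_quadratic (a0 b0 c0 : R) :
  is_derive2 (fun h => expR (a0 + b0 * h + c0 * h ^+ 2)) 0
    ((b0 ^+ 2 + 2 * c0) * expR a0).
Proof.
have dE (x : R) : is_derive x 1 (fun h => expR (a0 + b0 * h + c0 * h ^+ 2))
    (expR (a0 + b0 * x + c0 * x ^+ 2) * (b0 + 2 * c0 * x)).
  exact: (is_derive1_comp (is_derive_expR _) (is_derive_quadratic a0 b0 c0 x)).
eexists; split; first by near=> h; exact: dE.
apply: (is_derive_eq (is_derive_funM (dE 0) (is_derive_affine b0 (2 * c0) 0))).
by rewrite !mulr0 expr0n/= !mulr0 !addr0; ring.
Unshelve. all: by end_near. Qed.

Lemma is_derive2_sqr_quadratic (a0 b0 c0 : R) :
  is_derive2 (fun h => (a0 + b0 * h + c0 * h ^+ 2) ^+ 2) 0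
    (2 * b0 ^+ 2 + 4 * a0 * c0).
Proof.
have dq := is_derive_quadratic a0 b0 c0.
have dE (x : R) : is_derive x 1 (fun h => (a0 + b0 * h + c0 * h ^+ 2) ^+ 2)
    (2 * ((a0 + b0 * x + c0 * x ^+ 2) * (b0 + 2 * c0 * x))).
  by apply: (is_derive_eq (is_derive_funM (dq x) (dq x))); ring.
eexists; split; first by near=> h; exact: dE.
have dc : is_derive (0 : R) 1 (fun=> 2 : R) 0 := is_derive_cst _ _ _.
have dl := is_derive_affine b0 (2 * c0) 0.
apply: (is_derive_eq (is_derive_funM dc (is_derive_funM (dq 0) dl))).
ring.
Unshelve. all: by end_near. Qed.

(** At the minimum [F'] vanishes; if [a < 0], then [F'] is negative just to the right of [x], and
    the mean value theorem makes [F] drop below [F x]. Continuity of the second derivative does not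
    enter. *)
Lemma is_derive2_min F x a : is_derive2 F x a ->
  (\forall h \near x, F x <= F h) -> 0 <= a.
Proof.
move=> [F' [/nbhs_ballP[d1 /= d10 dF] dF']] /nbhs_ballP[d2 /= d20 Fmin].
have [d d0 [dd1 dd2]] : exists2 d : R, 0 < d & d < d1 /\ d < d2.
  exists (Num.min d1 d2 / 2); first by rewrite divr_gt0// lt_min d10.
  by split; rewrite ltr_pdivrMr// ?(minC d1); case: (leP d1 d2) => *; lra.
have bx (h : R) : `|h - x| <= d -> ball x d1 h /\ ball x d2 h.
  rewrite -ball_normE /= distrC => hd.
  by split; apply: le_lt_trans hd _.
have F0 : F' x = 0.
  have [|||//|_ <-] := @derive1_at_min _ F (x - d) (x + d) x.
  - by lra.
  - by move=> t; rewrite in_itv/= => tx; have [|/dF[]] := bx t; [rewrite ler_norml; lra|].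
  - by rewrite in_itv/=; lra.
  - by move=> t; rewrite in_itv/= => tx; have [|_] := bx t; [rewrite ler_norml; lra|exact: Fmin].
  by have [] := dF x (ballxx _ d10).
rewrite leNgt; apply/negP => a0.
move/is_derive_cvgP : dF'; rewrite F0 => cF'.
have : \forall h \near 0^', h^-1 * (F' (x + h *: 1) - 0) < 0.
  by apply: (cvgr_lt a).
rewrite near_withinE => /nbhs_ballP[d3 /= d30 neg].
pose h := Num.min d (d3 / 2).
have h0 : 0 < h by rewrite lt_min d0 divr_gt0.
have hd : h <= d by rewrite ge_min lexx.
have hd3 : h < d3 by apply: (@le_lt_trans _ _ (d3 / 2)); [rewrite ge_min lexx orbT|lra].
have [|||c] := @MVT _ F F' x (x + h); first by rewrite ltrDl.
- by move=> t txh; apply: dF; have [] // := bx t; move: txh; rewrite in_itv/= ler_norml; lra.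
- apply: derivable_within_continuous => t; rewrite in_itv/= => txh.
  by have [|/dF[]] := bx t; first by rewrite ler_norml; lra.
rewrite in_itv/= => /andP[xc cxh]; rewrite (addrC x h) addrK => E.
have : (c - x)^-1 * (F' (x + (c - x) *: 1) - 0) < 0.
  apply: neg; last by rewrite gt_eqF// subr_gt0.
  by rewrite -ball_normE /= sub0r normrN gtr0_norm; lra.
rewrite subr0 [_ *: 1]mulr1 (addrC x) subrK pmulr_rlt0 ?invr_gt0 ?subr_gt0// => Fc.
have : F x <= F (h + x) by apply: Fmin; have [] := bx (h + x); rewrite // addrK gtr0_norm.
by rewrite -subr_ge0 E pmulr_lge0// leNgt Fc.
Qed.

End SecondDerivative.

Section Laplacian.
Context {R : realType} {N : nat}.
Implicit Types (g : 'rV[R]_N -> R) (x e : 'rV[R]_N) (l : R).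

(** Only second derivatives along the coordinate lines through [x] are involved, so the minimum test
    and explicit barriers are handled in one variable. *)
Definition has_laplacian g x l := exists a : 'I_N -> R,
  (forall i, is_derive2 (fun h => g (x + h *: basis_vec R i)) 0 (a i)) /\
  l = \sum_(i < N) a i.

Lemma has_laplacianD g1 g2 x l1 l2 :
  has_laplacian g1 x l1 -> has_laplacian g2 x l2 ->
  has_laplacian (fun y => g1 y + g2 y) x (l1 + l2).
Proof.
move=> [a [da ->]] [b [db ->]]; exists (fun i => a i + b i).
by split; [move=> i; exact: is_derive2D|rewrite big_split].
Qed.

Lemma has_laplacianZ k g x l :
  has_laplacian g x l -> has_laplacian (fun y => k * g y) x (k * l).
Proof.
move=> [a [da ->]]; exists (fun i => k * a i).
by split; [move=> i; exact: is_derive2Z|rewrite mulr_sumr].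
Qed.

Lemma has_laplacian_cst k x : has_laplacian (fun=> k) x 0.
Proof.
by exists (fun=> 0); split; [move=> i; exact: is_derive2_cst|rewrite big1].
Qed.

Lemma has_laplacian_min g x l : has_laplacian g x l ->
  (\forall y \near x, g x <= g y) -> 0 <= l.
Proof.
move=> [a [da ->]] gmin; apply: sumr_ge0 => i _; apply: is_derive2_min (da i) _.
have : x + h *: basis_vec R i @[h --> 0] --> x.
  rewrite -[X in _ --> X]addr0; apply: cvgD; first exact: cvg_cst.
  rewrite -[X in _ --> X](scale0r (basis_vec R i)).
  by apply: cvgZr_tmp; exact: cvg_id.
by move=> /(_ _ gmin); rewrite scale0r addr0.
Qed.

Lemma dotv_line x v (h : R) : dotv (x + h *: v) (x + h *: v) =
  dotv x x + 2 * dotv x v * h + dotv v v * h ^+ 2.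
Proof. by rewrite !(dotvDl, dotvDr, dotvZl, dotvZr) (dotvC v x); ring. Qed.

Lemma has_laplacian_dotv x : has_laplacian (fun y => dotv y y) x (2 * N%:R).
Proof.
exists (fun=> 2 * 1); split => [i|]; last first.
  by rewrite big_const_ord iter_addr_0 mulr_natr mulr1.
have -> : (fun h => dotv (x + h *: basis_vec R i) (x + h *: basis_vec R i)) =
   (fun h => dotv x x + (2 * x 0 i) * h + 1 * h ^+ 2).
  by apply/funext => h; rewrite dotv_line dotv_basis1 dotv_basisr.
exact: is_derive2_quadratic.
Qed.

Lemma has_laplacian_expR_linear x e (k : R) :
  has_laplacian (fun y => expR (- (k * dotv y e))) x
    (k ^+ 2 * dotv e e * expR (- (k * dotv x e))).
Proof.
exists (fun i => ((- (k * e 0 i)) ^+ 2 + 2 * 0) * expR (- (k * dotv x e))).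
split => [i|]; last first.
  rewrite -mulr_suml; congr (_ * _); rewrite /dotv mulr_sumr.
  by apply: eq_bigr => i _; ring.
have -> : (fun h => expR (- (k * dotv (x + h *: basis_vec R i) e))) =
   (fun h => expR (- (k * dotv x e) + (- (k * e 0 i)) * h + 0 * h ^+ 2)).
  apply/funext => h; rewrite dotvDl dotvZl (dotvC (basis_vec _ _)) dotv_basisr.
  by congr expR; ring.
exact: is_derive2_expR_quadratic.
Qed.

Lemma has_laplacian_expR_dotv x (k c : R) :
  has_laplacian (fun y => expR (- (k * (dotv y y - c)))) x
    ((4 * k ^+ 2 * dotv x x - 2 * k * N%:R) * expR (- (k * (dotv x x - c)))).
Proof.
exists (fun i => ((- (2 * k * x 0 i)) ^+ 2 + 2 * - k) * expR (- (k * (dotv x x - c)))).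
split => [i|]; last first.
  rewrite -mulr_suml; congr (_ * _); rewrite big_split /= big_const_ord iter_addr_0.
  rewrite /dotv mulr_sumr -mulr_natr; congr (_ + _); last by ring.
  by apply: eq_bigr => i _; ring.
have -> : (fun h => expR (- (k * (dotv (x + h *: basis_vec R i) (x + h *: basis_vec R i) - c)))) =
   (fun h => expR (- (k * (dotv x x - c)) + (- (2 * k * x 0 i)) * h + - k * h ^+ 2)).
  apply/funext => h; rewrite dotv_line dotv_basis1 dotv_basisr.
  by congr expR; ring.
exact: is_derive2_expR_quadratic.
Qed.

Lemma has_laplacian_sqr_dotv x y (c : R) :
  has_laplacian (fun z => (c - dotv (z - y) (z - y)) ^+ 2) x
    (8 * dotv (x - y) (x - y) - 4 * N%:R * (c - dotv (x - y) (x - y))).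
Proof.
pose q := x - y.
exists (fun i => 2 * (- (2 * q 0 i)) ^+ 2 + 4 * (c - dotv q q) * - 1).
split => [i|]; last first.
  rewrite big_split /= big_const_ord iter_addr_0 -mulr_natr -/q.
  rewrite {1}/dotv mulr_sumr; congr (_ + _); last by ring.
  by apply: eq_bigr => i _; ring.
have -> : (fun h => (c - dotv (x + h *: basis_vec R i - y) (x + h *: basis_vec R i - y)) ^+ 2) =
   (fun h => (c - dotv q q + (- (2 * q 0 i)) * h + - 1 * h ^+ 2) ^+ 2).
  apply/funext => h; rewrite (_ : x + _ - y = q + h *: basis_vec R i); last first.
    by rewrite addrAC.
  by rewrite dotv_line dotv_basis1 dotv_basisr; congr (_ ^+ 2); ring.
exact: is_derive2_sqr_quadratic.
Qed.

End Laplacian.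

(** * From partial derivatives to derivatives along arbitrary lines, and reflection invariance of
    the Laplacian *)

Section DirectionalDerivatives.
Context {R : realType} {N : nat}.
Implicit Types (g : 'rV[R]_N -> R) (x y v e : 'rV[R]_N) (A : set 'rV[R]_N).

Lemma mean_value_two_sided (F F' : R -> R) (r : R) :
  (forall s : R, `|s| <= `|r| -> is_derive s 1 F (F' s)) ->
  exists2 xi, `|xi| <= `|r| & F r - F 0 = F' xi * r.
Proof.
move=> dF; case: (ltgtP r 0) => [r0|r0|->]; last first.
- by exists 0 => //; rewrite mulr0 subrr.
- have [||c] := @MVT _ F F' 0 r r0.
  + by move=> s; rewrite in_itv/= => s0r; apply: dF; rewrite !gtr0_norm; lra.
  + apply: derivable_within_continuous => s; rewrite in_itv/= => s0r.
    suff [] : is_derive s 1 F (F' s) by []; apply: dF; rewrite !ger0_norm; lra.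
  + rewrite in_itv/= subr0 => c0r E; exists c => //.
    by rewrite !gtr0_norm; lra.
- have [||c] := @MVT _ F F' r 0 r0.
  + by move=> s; rewrite in_itv/= => s0r; apply: dF; rewrite !ltr0_norm; lra.
  + apply: derivable_within_continuous => s; rewrite in_itv/= => s0r.
    suff [] : is_derive s 1 F (F' s) by []; apply: dF; rewrite !ler0_norm; lra.
  + rewrite in_itv/= sub0r => c0r E; exists c => //.
      by rewrite !ltr0_norm; lra.
    by lra.
Qed.

Lemma is_derive_line g y v (s l : R) :
  is_derive (y + s *: v) v g l <-> is_derive s 1 (fun h => g (y + h *: v)) l.
Proof.
rewrite !is_derive_cvgP; set f1 := (X in fmap X _ --> _ <-> _).
set f2 := (X in _ <-> fmap X _ --> _); suff -> : f1 = f2 by [].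
apply/funext => h; rewrite /f1 /f2 /= scalerDl addrA.
by rewrite [_ *: 1]mulr1.
Qed.

Lemma cvg_line x v : x + h *: v @[h --> (0 : R)] --> x.
Proof.
rewrite -[X in _ --> X]addr0; apply: cvgD; first exact: cvg_cst.
rewrite -[X in _ --> X](scale0r v).
by apply: cvgZr_tmp; exact: cvg_id.
Qed.

(** The increment along [v + c b] is the one along [v] followed by one along [b] from the moved base
    point. The mean value theorem rewrites the latter as [c] times a nearby value of the partial
    derivative, whose continuity at [x] gives the limit. *)
Lemma is_derive_add_coord g x v (i : 'I_N) (c l : R) :
  is_derive x v g l ->
  (\forall y \near x, derivable g y (basis_vec R i)) ->
  {for x, continuous (partial_x i g)} ->
  is_derive x (v + c *: basis_vec R i) g (l + c * partial_x i g x).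
Proof.
set b := basis_vec R i => /is_derive_cvgP gl dg cg; apply/is_derive_cvgP.
have -> : (fun h => h^-1 * (g (x + h *: (v + c *: b)) - g x)) =
    (fun h => h^-1 * (g (x + h *: v) - g x) +
      h^-1 * (g ((x + h *: v) + (h * c) *: b) - g (x + h *: v))).
  by apply/funext => h; rewrite -mulrDr scalerDr scalerA addrA; congr (_ * _); ring.
apply: cvgD => //; apply/cvgrPdist_le => eps eps0.
have eps'0 : 0 < eps / (`|c| + 1) by rewrite divr_gt0// ltr_wpDl.
have /nbhs_ballP[d /= d0 gd] : \forall y \near x, derivable g y b /\
    `|partial_x i g x - partial_x i g y| <= eps / (`|c| + 1).
  apply: filterI => //; exact: (cvgr_dist_le (FF := nbhs_filter x) _ _ cg).
have d2 : 0 < d / 2 by rewrite divr_gt0.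
(* For [|h| < k] the whole segment used by the mean value theorem stays in the ball of radius [d];
   the [+ 1] keeps the denominator positive. *)
pose k := d / 2 / (`|c * `|b| | + `|v| + 1).
have k0 : 0 < k by rewrite divr_gt0// ltr_wpDl// addr_ge0.
rewrite near_withinE; apply/nbhs_ballP; exists k => //= h.
rewrite -ball_normE/= sub0r normrN => hk h0.
have inb s : `|s| <= `|h * c| -> ball x d (x + h *: v + s *: b).
  move=> sh; rewrite -ball_normE/= -addrA opprD addrA subrr sub0r normrN.
  apply: le_lt_trans (ler_normD _ _) _; rewrite !normrZ.
  apply: (@le_lt_trans _ _ (`|h| * (`|c * `|b| | + `|v| + 1))).
    rewrite !mulrDr [leLHS]addrC -addrA lerD//; last by rewrite lerDl mulr1.
    rewrite normrM normr_id mulrA -normrM.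
    by apply: ler_wpM2r.
  apply: (@lt_trans _ _ (d / 2)); last by lra.
  by rewrite -ltr_pdivlMr// ltr_wpDl// addr_ge0.
have [|xi xih] := @mean_value_two_sided (fun s => g (x + h *: v + s *: b))
    (fun s => partial_x i g (x + h *: v + s *: b)) (h * c).
  move=> s sh; apply/is_derive_line; have [dgs _] := gd _ (inb _ sh).
  exact: DeriveDef dgs erefl.
rewrite scale0r addr0 => ->.
rewrite (_ : h^-1 * _ = c * partial_x i g (x + h *: v + xi *: b)); last by field.
rewrite -mulrBr normrM.
have [_ /(ler_wpM2l (normr_ge0 c))] := gd _ (inb _ xih).
move=> /le_trans; apply; rewrite mulrA ler_pdivrMr ?ltr_wpDl//.
by rewrite mulrC ler_pM2l// lerDl.
Qed.

Lemma is_derive_partials A g x v : open A -> A x ->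
  (forall i y, A y -> derivable g y (basis_vec R i)) ->
  (forall i, {for x, continuous (partial_x i g)}) ->
  is_derive x v g (\sum_(i < N) v 0 i * partial_x i g x).
Proof.
move=> oA Ax dg cg; rewrite [v in is_derive _ v](row_sum_delta v).
elim: (index_enum _) => [|i r IH]; first by rewrite !big_nil; exact: is_derive0.
rewrite !big_cons addrC [X in is_derive _ _ _ X]addrC.
apply: is_derive_add_coord => //.
by apply: filterS (open_nbhs_nbhs (conj oA Ax)) => y Ay; exact: dg.
Qed.

Lemma is_derive2_line A g x v : open A -> A x ->
  (forall i y, A y -> derivable g y (basis_vec R i)) ->
  (forall i y, A y -> {for y, continuous (partial_x i g)}) ->
  (forall i j y, A y -> derivable (partial_x i g) y (basis_vec R j)) ->
  (forall i j y, A y -> {for y, continuous (partial_x j (partial_x i g))}) ->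
  is_derive2 (fun h => g (x + h *: v)) 0
    (\sum_(i < N) v 0 i * \sum_(j < N) v 0 j * partial_x j (partial_x i g) x).
Proof.
move=> oA Ax dg cg ddg cdg.
exists (fun h => \sum_(i < N) v 0 i * partial_x i g (x + h *: v)); split.
  have nA := @cvg_line x v A (open_nbhs_nbhs (conj oA Ax)).
  near=> h; apply/is_derive_line; apply: (is_derive_partials _ oA) => //.
    by near: h.
  by move=> i; apply: cg; near: h.
have -> : (fun h => \sum_(i < N) v 0 i * partial_x i g (x + h *: v)) =
    \sum_(i < N) (fun h : R => v 0 i * partial_x i g (x + h *: v)).
  by apply/funext => h; rewrite fct_sumE.
apply: is_derive_sum => i.
have d : is_derive (0 : R) 1 (fun h => partial_x i g (x + h *: v))
    (\sum_(j < N) v 0 j * partial_x j (partial_x i g) x).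
  apply/is_derive_line; rewrite scale0r addr0.
  apply: (is_derive_partials _ oA Ax); [exact: ddg|by move=> j; exact: cdg].
have dc : is_derive (0 : R) 1 (fun=> v 0 i) 0 := is_derive_cst _ _ _.
by apply: (is_derive_eq (is_derive_funM dc d)); rewrite mulr0 addr0.
Unshelve. all: by end_near. Qed.

(* The Hessian is evaluated on the orthonormal frame of reflected basis
   vectors, so its trace is unchanged. *)
Lemma has_laplacian_refl A g e x : e != 0 -> open A -> A (refl e x) ->
  (forall i y, A y -> derivable g y (basis_vec R i)) ->
  (forall i y, A y -> {for y, continuous (partial_x i g)}) ->
  (forall i j y, A y -> derivable (partial_x i g) y (basis_vec R j)) ->
  (forall i j y, A y -> {for y, continuous (partial_x j (partial_x i g))}) ->
  has_laplacian (g \o refl e) x (laplacian g (refl e x)).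
Proof.
move=> e0 oA Ax dg cg ddg cdg; set H := fun i j => partial_x j (partial_x i g) (refl e x).
pose b (k : 'I_N) := refl e (basis_vec R k).
exists (fun k => \sum_(i < N) b k 0 i * \sum_(j < N) b k 0 j * H i j); split => [k|].
  rewrite (_ : (fun h => _) = (fun h => g (refl e x + h *: b k))).
    exact: is_derive2_line oA Ax dg cg ddg cdg.
  by apply/funext => h /=; rewrite refl_line.
rewrite exchange_big /=; apply: eq_bigr => i _.
under eq_bigr do rewrite mulr_sumr.
rewrite exchange_big /= (bigD1 i)//= [X in _ + X]big1 ?addr0 => [|j ji].
  under eq_bigr do rewrite mulrA.
  by rewrite -mulr_suml refl_basis_sum// eqxx mul1r.
under eq_bigr do rewrite mulrA.
by rewrite -mulr_suml refl_basis_sum// eq_sym (negbTE ji) mul0r.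
Qed.

Lemma has_laplacian_C2 A g x : open A -> A x ->
  (forall i y, A y -> derivable g y (basis_vec R i)) ->
  (forall i y, A y -> {for y, continuous (partial_x i g)}) ->
  (forall i j y, A y -> derivable (partial_x i g) y (basis_vec R j)) ->
  (forall i j y, A y -> {for y, continuous (partial_x j (partial_x i g))}) ->
  has_laplacian g x (laplacian g x).
Proof.
move=> oA Ax dg cg ddg cdg.
exists (fun k => partial_x k (partial_x k g) x); split => // k.
have := is_derive2_line (basis_vec R k) oA Ax dg cg ddg cdg.
rewrite (bigD1 k)//= [X in _ + X]big1 ?addr0 => [|i ik]; last first.
  by rewrite mxE (negbTE ik) andbF mul0r.
rewrite (bigD1 k)//= [X in _ + X]big1 ?addr0 => [|i ik]; last first.
  by rewrite mxE (negbTE ik) andbF mul0r.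
by rewrite mxE !eqxx !mul1r.
Qed.

End DirectionalDerivatives.

(** * Parabolic comparison and positivity *)

Section HeatOperator.
Context {R : realType} {N : nat}.
Implicit Types (w P : 'rV[R]_N -> R -> R) (x : 'rV[R]_N) (t m : R).

Definition heat_at w x t m := exists d l,
  [/\ is_derive t 1 (w x) d, has_laplacian (w ^~ t) x l & d - l = m].

Lemma heat_atD w1 w2 x t m1 m2 : heat_at w1 x t m1 -> heat_at w2 x t m2 ->
  heat_at (fun y s => w1 y s + w2 y s) x t (m1 + m2).
Proof.
move=> [d1 [l1 [D1 L1 <-]]] [d2 [l2 [D2 L2 <-]]].
exists (d1 + d2), (l1 + l2); split; last by ring.
  exact: is_deriveD.
exact: has_laplacianD.
Qed.

Lemma heat_at_separable (a : R -> R) g x t da lg :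
  is_derive t 1 a da -> has_laplacian g x lg ->
  heat_at (fun y s => a s * g y) x t (da * g x - a t * lg).
Proof.
move=> Da Lg; exists (da * g x), (a t * lg); split => //; last exact: has_laplacianZ.
have dc : is_derive t 1 (fun=> g x) 0 := is_derive_cst _ _ _.
by apply: (is_derive_eq (is_derive_funM Da dc)); rewrite mulr0 add0r mulrC.
Qed.

Lemma is_derive_expR_shift (k c t0 t : R) :
  is_derive t 1 (fun s => c * expR (k * (s - t0))) (c * k * expR (k * (t - t0))).
Proof.
have d0 := is_derive_affine (- (k * t0)) k t.
have d1 := is_derive1_comp (is_derive_expR _) d0.
have dc : is_derive t 1 (fun=> c) 0 := is_derive_cst _ _ _.
have := is_derive_funM dc d1.
rewrite (_ : (fun h => _) = (fun s => c * expR (k * (s - t0)))); last first.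
  by apply/funext => s /=; congr (_ * expR _); ring.
move=> d; apply: (is_derive_eq d); rewrite mulr0 addr0 /=.
by rewrite (_ : - (k * t0) + k * t = k * (t - t0)); ring.
Qed.

Lemma cvg_uncurry w (T : Type) (F : set_system T) {FF : Filter F}
    (f : T -> 'rV[R]_N) (g : T -> R) x t :
  continuous (fun z => w z.1 z.2) -> f @ F --> x -> g @ F --> t ->
  (fun s => w (f s) (g s)) @ F --> w x t.
Proof. by move=> cw fx gt; exact: (cvg_comp _ _ (cvg_pair fx gt) (cw (x, t))). Qed.

(** Continuity from the left in time gives [w + P >= 0] near [x0] at time [t0]. So [x0] is a local
    minimum in space and the Laplacian is nonnegative there, while the left difference quotients in
    time are nonpositive. *)
Lemma heat_at_touch w P x0 t0 m p :
  continuous (fun z => w z.1 z.2) -> continuous (fun z => P z.1 z.2) ->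
  heat_at w x0 t0 m -> heat_at P x0 t0 p ->
  w x0 t0 + P x0 t0 <= 0 ->
  (\forall z \near (x0, t0), z.2 < t0 -> 0 < w z.1 z.2 + P z.1 z.2) ->
  w x0 t0 + P x0 t0 = 0 /\ m + p <= 0.
Proof.
move=> cw cP hw hP Z0 [[A B] /= [nA nB] AB].
pose Z x t := w x t + P x t.
have cZ x : continuous (Z x).
  by move=> t; apply: cvgD; apply: cvg_uncurry => //; exact: cvg_cst || exact: cvg_id.
have Zge0 x : A x -> 0 <= Z x t0.
  move=> Ax; apply: (cvgr_to_ge (cvg_at_left_filter (cZ x t0))).
  near=> t; apply/ltW/(AB (x, t)); last by near: t; exact: nbhs_left_lt.
  by split => //; near: t; rewrite near_withinE; apply: filterS nB.
have E : Z x0 t0 = 0.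
  by apply/eqP; rewrite eq_le Z0 Zge0//; exact: nbhs_singleton nA.
split=> //; have [d [l [D L <-]]] := heat_atD hw hP.
have l0 : 0 <= l.
  by apply: has_laplacian_min L _; apply: filterS nA => x Ax; rewrite -/(Z x0 t0) E Zge0.
suff : d <= 0 by lra.
move/is_derive_cvgP : D => /cvg_dnbhs_at_left D; apply: (cvgr_to_le D).
have nB' : \forall h \near (0 : R), B (t0 + h).
  apply: (_ : t0 + h @[h --> (0 : R)] --> t0); last exact: nB.
  by rewrite -[X in _ --> X]addr0; apply: cvgD; [exact: cvg_cst|exact: cvg_id].
near=> h.
have h0 : h < 0 by near: h; exact: nbhs_left_lt.
rewrite [h *: 1]mulr1; rewrite -/(Z x0 t0) E subr0.
rewrite nmulr_rle0 ?invr_lt0//; apply/ltW/(AB (x0, t0 + h)) => /=; last by lra.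
split; first exact: nbhs_singleton nA.
by near: h; rewrite near_withinE; apply: filterS nB'.
Unshelve. all: by end_near. Qed.

(** The time coordinate attains its minimum on the compact set where [Z <= 0]. *)
Lemma earliest_nonpos (G : set ('rV[R]_N * R)) (Z : 'rV[R]_N * R -> R) :
  compact G -> continuous Z -> (exists2 z, G z & Z z <= 0) ->
  exists z0, [/\ G z0, Z z0 <= 0 & forall z, G z -> z.2 < z0.2 -> 0 < Z z].
Proof.
move=> cG cZ [z1 Gz1 Zz1].
have c' : compact (G `&` [set z | Z z <= 0]).
  apply: compact_closedI => //; apply: (@preimage_closed _ _ Z [set y | y <= 0]).
    by move=> z _; exact: cZ.
  exact: closed_le.
have [||z0] := compact_EVT_min _ c' (f := snd).
- by exists z1.
- by apply: continuous_subspaceT => z; exact: cvg_snd.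
rewrite inE => -[Gz0 Zz0] z0min; exists z0; split => // z Gz zz0.
rewrite ltNge; apply/negP => Zz; move: zz0; rewrite ltNge => /negP; apply.
by apply: z0min; rewrite inE.
Qed.

(* The auxiliary term [eta * expR (K t) * (1 + |x|^2)] keeps the first touching
   point bounded, so no decay of [w] in [x] is needed. *)
Lemma comparison_unbounded w (D H : set 'rV[R]_N) (phi : 'rV[R]_N -> R)
    (b : R -> R) (B C M tau : R) :
  continuous (fun z => w z.1 z.2) -> (forall x t, 0 <= t -> `|w x t| <= B) ->
  open D -> closed H -> D `<=` H -> continuous phi -> continuous b ->
  (forall x, H x -> 0 <= phi x) -> (forall t, 0 <= b t) -> b 0 = 1 ->
  0 <= C -> 0 <= M ->
  (forall x t, H x -> ~ D x -> 0 <= t -> 0 <= w x t) ->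
  (forall x, H x -> - (M * phi x) <= w x 0) ->
  (forall x t, D x -> 0 < t -> t <= tau -> 0 <= w x t \/
    exists c, [/\ heat_at w x t (c * w x t), c <= C &
      exists lam l, [/\ has_laplacian phi x l,
        \forall s \near t, s < t -> b s <= b t * expR (lam * (s - t)) &
        0 <= lam * phi x - l - c * phi x]]) ->
  forall x t, H x -> 0 <= t -> t <= tau -> - (M * b t * phi x) <= w x t.
Proof.
move=> cw wB oD cH DH cphi cb phi0 b0 b01 C0 M0 wbd w0 wint x1 t1 Hx1 t10 t1tau.
(* [2 N] is the Laplacian of [1 + |x|^2], so this rate makes the auxiliary term a strict
   supersolution for every coefficient [c <= C]. *)
pose K := C + 2 * N%:R + 1.
have K0 : 0 < K by rewrite /K ltr_wpDl// addr_ge0// mulr_ge0.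
have B0 : 0 <= B by apply: le_trans (wB x1 0 (lexx 0)).
pose Q eta (x : 'rV[R]_N) t := (eta * expR (K * (t - 0))) * (1 + dotv x x).
suff main (eta : R) : 0 < eta -> 0 < w x1 t1 + (M * b t1 * phi x1 + Q eta x1 t1).
  apply/ler_addgt0Pr => eps eps0.
  have k0 : 0 < expR (K * (t1 - 0)) * (1 + dotv x1 x1).
    by rewrite mulr_gt0 ?expR_gt0// ltr_pwDl// dotv_ge0.
  have := main (eps / (expR (K * (t1 - 0)) * (1 + dotv x1 x1))) (divr_gt0 eps0 k0).
  by rewrite /Q -(mulrA (eps / _)) divfK ?gt_eqF//; lra.
move=> eta0.
have cdot : continuous (fun x : 'rV[R]_N => dotv x x).
  by move=> x; apply: (@cvg_dotv _ _ _ (nbhs x) _ id id); exact: cvg_id.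
have cQ : continuous (fun z => Q eta z.1 z.2).
  move=> z; apply: cvgM.
    apply: cvgM; first exact: cvg_cst.
    apply: (@cvg_comp _ _ _ snd (fun t => expR (K * (t - 0)))); first exact: cvg_snd.
    apply: (@continuous_comp _ _ _ (fun t => K * (t - 0)) expR).
      by apply: cvgM; [exact: cvg_cst|apply: cvgB; [exact: cvg_id|exact: cvg_cst]].
    exact: continuous_expR.
  apply: cvgD; first exact: cvg_cst.
  by apply: (@cvg_comp _ _ _ fst (fun x => dotv x x)); [exact: cvg_fst|exact: cdot].
have cPhi : continuous (fun z : 'rV[R]_N * R => phi z.1).
  by move=> z; apply: (@cvg_comp _ _ _ fst phi); [exact: cvg_fst|exact: cphi].
have Qge x t : 0 <= t -> eta * (1 + dotv x x) <= Q eta x t.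
  move=> t0; rewrite /Q -mulrA ler_pM2l// ler_peMl ?addr_ge0// ?dotv_ge0//.
  by rewrite -expR0 ler_expR subr0 mulr_ge0// ltW.
have Qgt0 x t : 0 <= t -> 0 < Q eta x t.
  move=> /(Qge x); apply: lt_le_trans.
  by rewrite mulr_gt0// ltr_pwDl// dotv_ge0.
have MbP x t : H x -> 0 <= M * b t * phi x.
  by move=> Hx; rewrite !mulr_ge0// phi0.
(* Beyond this radius the auxiliary term alone exceeds the bound [B] of [w], so a touching point
   must lie strictly inside. *)
pose r := enorm x1 + B / eta + 1.
have r1 : 1 <= r by rewrite /r lerDr addr_ge0 ?enorm_ge0// divr_ge0// ltW.
have far x t : 0 <= t -> H x -> r <= enorm x -> 0 < w x t + (M * b t * phi x + Q eta x t).
  move=> t0 Hx rx; have := wB x t t0; rewrite ler_norml => /andP[wBl _].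
  have := MbP x t Hx; have := Qge x t t0.
  suff : B < eta * (1 + dotv x x) by lra.
  have : B < eta * r.
    rewrite /r !mulrDr mulrCA divff ?gt_eqF// mulr1.
    by have := mulr_ge0 (ltW eta0) (enorm_ge0 x1); lra.
  move=> /lt_le_trans; apply; rewrite ler_pM2l//.
  have : r ^+ 2 <= dotv x x by rewrite -ge_enormP//; lra.
  have : r <= r ^+ 2 by rewrite expr2; nra.
  by lra.
rewrite ltNge; apply/negP => Zle.
pose G := ([set x | H x /\ enorm x <= r] `*` `[0, tau]) : set ('rV[R]_N * R).
have cG : compact G.
  apply: compact_setX; last exact: segment_compact.
  rewrite (_ : [set x | _] = [set x | enorm x <= r] `&` H).
    by apply: compact_closedI => //; exact: compact_enorm_le.
  by apply/seteqP; split => x /= [].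
have [||[x0 t0] [[[/= Hx0 x0r] t0I]]] := earliest_nonpos cG
  (Z := fun z => w z.1 z.2 + (M * b z.2 * phi z.1 + Q eta z.1 z.2)).
- move=> z; apply: cvgD; first exact: cw.
  apply: cvgD; last exact: cQ.
  apply: cvgM; last exact: cPhi.
  by apply: cvgM; [exact: cvg_cst|apply: (@cvg_comp _ _ _ snd b); [exact: cvg_snd|exact: cb]].
- exists (x1, t1) => //=; split; rewrite /= ?in_itv/= ?t10//; split => //.
  by rewrite /r -addrA lerDl addr_ge0// divr_ge0// ltW.
move: t0I; rewrite in_itv/= => /andP[t00 t0tau].
move=> /= Z0 Zpos.
have t0gt : 0 < t0.
  rewrite lt_neqAle t00 andbT; apply/eqP => t0E; move: Z0; rewrite leNgt => /negP; apply.
  by rewrite -t0E b01 mulr1; have := w0 _ Hx0; have := Qgt0 x0 0 (lexx 0); lra.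
have wlt : w x0 t0 < 0.
  by have := Qgt0 x0 t0 t00; have := MbP x0 t0 Hx0; lra.
have Dx0 : D x0 by apply: contrapT => /(wbd _ _ Hx0)/(_ t00); lra.
have x0r' : enorm x0 < r.
  by rewrite ltNge; apply/negP => /(far _ _ t00 Hx0); lra.
have [|[c [hw cC [lam [l [hl blam sup]]]]]] := wint _ _ Dx0 t0gt t0tau; first by lra.
(* [b] may fail to be differentiable at [t0]. The exponential agrees with it there and lies above it
   just before, so the sum stays positive before [t0] and the touching argument applies to a smooth
   function of time. *)
pose P x t := (M * b t0 * expR (lam * (t - t0))) * phi x + Q eta x t.
have cP : continuous (fun z => P z.1 z.2).
  move=> z; apply: cvgD; last exact: cQ.
  apply: cvgM; last exact: cPhi.
  apply: cvgM; first exact: cvg_cst.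
  apply: (@cvg_comp _ _ _ snd (fun t => expR (lam * (t - t0)))); first exact: cvg_snd.
  apply: (@continuous_comp _ _ _ (fun t => lam * (t - t0)) expR).
    by apply: cvgM; [exact: cvg_cst|apply: cvgB; [exact: cvg_id|exact: cvg_cst]].
  exact: continuous_expR.
have hP := heat_atD (heat_at_separable (is_derive_expR_shift lam (M * b t0) t0 t0) hl)
  (heat_at_separable (is_derive_expR_shift K eta 0 t0)
    (has_laplacianD (has_laplacian_cst 1 x0) (has_laplacian_dotv x0))).
have P0 : P x0 t0 = M * b t0 * phi x0 + Q eta x0 t0.
  by rewrite /P subrr mulr0 expR0 mulr1.
have [||E] := heat_at_touch cw cP hw hP.
- by rewrite P0.
- have nx : \forall x \near x0, D x /\ enorm x < r.
    apply: filterI; first exact: open_nbhs_nbhs.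
    exact: (cvgr_lt (enorm x0) (@continuous_enorm _ _ x0) r x0r').
  have nt : \forall t \near t0, 0 < t /\
      (t < t0 -> b t <= b t0 * expR (lam * (t - t0))).
    by apply: filterI => //; exact: lt_nbhsr.
  exists ([set x | D x /\ enorm x < r], [set t | 0 < t /\
      (t < t0 -> b t <= b t0 * expR (lam * (t - t0)))]) => //= -[x t] /= [[Dx xr] [tgt bt] tt0].
  have Gxt : G (x, t).
    split => /=; first by split; [exact: DH|exact: ltW].
    by rewrite in_itv/= (ltW tgt) (le_trans (ltW tt0)).
  apply: lt_le_trans (Zpos _ Gxt tt0) _ => /=.
  rewrite lerD2l lerD2r; apply: ler_wpM2r; first exact/phi0/DH.
  by rewrite -mulrA; apply: ler_wpM2l => //; exact: bt.
rewrite subrr mulr0 expR0 mulr1.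
have -> : w x0 t0 = - (M * b t0 * phi x0 + Q eta x0 t0) by rewrite -P0; lra.
rewrite /Q; set k := eta * expR _.
have k0 : 0 < k by rewrite mulr_gt0 ?expR_gt0.
have Mb0 : 0 <= M * b t0 by rewrite mulr_ge0.
have := mulr_ge0 Mb0 sup.
have : 0 < k * ((K - c) * (1 + dotv x0 x0) - 2 * N%:R).
  rewrite mulr_gt0//.
  have : 2 * N%:R + 1 <= K - c by rewrite /K; lra.
  have := dotv_ge0 x0; have : 0 <= 2 * N%:R :> R by rewrite mulr_ge0.
  by nra.
move=> h1 h2; have -> : eta * K * expR (K * (t0 - 0)) = K * k by rewrite /k; ring.
by rewrite add0r; lra.
Qed.

End HeatOperator.

(** * Strong maximum principle on a ball, forward in time *)

Section StrongMaximum.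
Context {R : realType} {N : nat}.
Implicit Types (w : 'rV[R]_N -> R -> R) (x y : 'rV[R]_N) (t : R).

(* The subsolution [mu expR (- kap (t - t1)) E ^+ 2], with
   [E = del ^+ 2 + s (t - t1) - |x - x1| ^+ 2] vanishing on the edge of an
   expanding ball. *)
Lemma positivity_spreads w (x1 : 'rV[R]_N) (r C t1 : R) :
  continuous (fun z => w z.1 z.2) -> 0 < r -> 0 <= t1 -> 0 <= C ->
  (forall x t, enorm (x - x1) <= r -> 0 <= t -> 0 <= w x t) ->
  (forall x t, enorm (x - x1) <= r -> 0 < t ->
     exists2 c, `|c| <= C & heat_at w x t (c * w x t)) ->
  0 < w x1 t1 ->
  forall x t, enorm (x - x1) < r -> t1 < t -> 0 < w x t.
Proof.
move=> cw r0 t10 C0 wpos hw w1 x2 t2 x2r t12.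
pose m := w x1 t1 / 2.
have m0 : 0 < m by rewrite divr_gt0.
have [d d0 dm] : exists2 d : R, 0 < d & forall x, `|x - x1| < d -> m < w x t1.
  have wc : w x t1 @[x --> x1] --> w x1 t1.
    by apply: (@cvg_uncurry _ _ w _ (nbhs x1) _ id (fun=> t1)) => //; exact: cvg_cst.
  have /nbhs_ballP[e /= e0 em] : \forall x \near x1, m < w x t1.
    by apply: (cvgr_gt _ wc); rewrite /m; lra.
  by exists e => // x xe; apply: em; rewrite -ball_normE/= distrC.
(* On the ball of radius [del] the solution exceeds [m] at time [t1]; the speed [s] below makes the
   squared radius grow from [del ^+ 2] at [t1] to [r ^+ 2] at [t2]. *)
pose del := Num.min (d / 2) (r / 2).
have del0 : 0 < del by rewrite lt_min !divr_gt0.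
have deld : del < d by rewrite gt_min; apply/orP; left; lra.
have delr : del < r by rewrite gt_min; apply/orP; right; lra.
pose s := (r ^+ 2 - del ^+ 2) / (t2 - t1).
have s0 : 0 < s.
  by rewrite divr_gt0 ?subr_gt0// ltr_sqr ?nnegrE ?ltW.
pose E (x : 'rV[R]_N) t := del ^+ 2 + s * (t - t1) - dotv (x - x1) (x - x1).
(* With [y = E x t], one has [8 |x - x1|^2 >= 8 del^2 - 8 y], so the subsolution inequality reduces
   to [(c + kap) y^2 - a y + 8 del^2 >= 0]. The [C] in [kap] absorbs [c], the rest completes the
   square; [mu] makes the subsolution at most [m] at time [t1]. *)
pose a := 2 * s + 4 * N%:R + 8.
pose kap := C + a ^+ 2 / (32 * del ^+ 2).
pose mu := m / del ^+ 4.
have mu0 : 0 < mu by rewrite divr_gt0// exprn_gt0.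
pose psi (x : 'rV[R]_N) t := (mu * expR (- kap * (t - t1))) * E x t ^+ 2.
(* The rate [C + 1 > c] makes the inequality at the touching point strict; [eta] is sent to 0
   afterwards. *)
pose Q eta (x : 'rV[R]_N) t := (eta * expR ((C + 1) * (t - t1))) * 1 : R.
have E2 x : E x t2 = r ^+ 2 - dotv (x - x1) (x - x1).
  by rewrite /E /s divfK; [lra|rewrite subr_eq0 gt_eqF].
have psi2 : 0 < psi x2 t2.
  apply: mulr_gt0; first by rewrite mulr_gt0 ?expR_gt0.
  rewrite exprn_gt0// E2 subr_gt0.
  by rewrite -sqr_enorm ltr_sqr ?nnegrE ?enorm_ge0// ltW.
suff main (eta : R) : 0 < eta -> 0 < w x2 t2 + (- psi x2 t2 + Q eta x2 t2).
  apply: lt_le_trans psi2 _; apply/ler_addgt0Pr => eps eps0.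
  have k0 : 0 < expR ((C + 1) * (t2 - t1)) by rewrite expR_gt0.
  have := main (eps / expR ((C + 1) * (t2 - t1))) (divr_gt0 eps0 k0).
  by rewrite /Q mulr1 divfK ?gt_eqF//; lra.
move=> eta0.
have cexp k : continuous (fun z : 'rV[R]_N * R => expR (k * (z.2 - t1))).
  move=> z; apply: (@cvg_comp _ _ _ snd (fun t => expR (k * (t - t1)))); first exact: cvg_snd.
  apply: (@continuous_comp _ _ _ (fun t => k * (t - t1)) expR).
    by apply: cvgM; [exact: cvg_cst|apply: cvgB; [exact: cvg_id|exact: cvg_cst]].
  exact: continuous_expR.
have cE : continuous (fun z => E z.1 z.2).
  move=> z; apply: cvgB.
    apply: cvgD; first exact: cvg_cst.
    by apply: cvgM; [exact: cvg_cst|apply: cvgB; [exact: cvg_snd|exact: cvg_cst]].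
  have cz : z'.1 - x1 @[z' --> z] --> z.1 - x1.
    by apply: cvgB; [exact: cvg_fst|exact: cvg_cst].
  exact: (cvg_dotv cz cz).
pose P x t := - psi x t + Q eta x t.
have cP : continuous (fun z => P z.1 z.2).
  move=> z; apply: cvgD.
    apply: cvgN; apply: cvgM.
      by apply: cvgM; [exact: cvg_cst|exact: cexp].
    exact: (cvg_comp _ _ (cE z) (@exprn_continuous _ 2 _)).
  apply: cvgM; last exact: cvg_cst.
  by apply: cvgM; [exact: cvg_cst|exact: cexp].
have Qgt0 x t : 0 < Q eta x t by rewrite /Q mulr1 mulr_gt0 ?expR_gt0.
rewrite ltNge; apply/negP => Zle.
pose G := (([set x | enorm (x - x1) <= r] `*` `[t1, t2]) `&` [set z | 0 <= E z.1 z.2])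
   : set ('rV[R]_N * R).
have cG : compact G.
  apply: compact_closedI.
    apply: compact_setX; last exact: segment_compact.
    rewrite (_ : [set x | _] = (+%R x1) @` [set x | enorm x <= r]).
      apply: continuous_compact; last exact: compact_enorm_le.
      apply: continuous_subspaceT => x.
      by apply: (@cvgD _ _ _ (nbhs x) _ (fun=> x1) id); [exact: cvg_cst|exact: cvg_id].
    apply/seteqP; split => [x /= xr|_ /= [x xr <-]]; last by rewrite addrC addKr.
    by exists (x - x1) => //; rewrite addrC subrK.
  apply: (@preimage_closed _ _ (fun z => E z.1 z.2) [set y | 0 <= y]); last exact: closed_ge.
  by move=> z _; exact: cE.
have [||[x0 t0] [[[/= x0r t0I] E0]]] := earliest_nonpos cG
  (Z := fun z => w z.1 z.2 + P z.1 z.2).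
- by move=> z; apply: cvgD; [exact: cw|exact: cP].
- exists (x2, t2) => //=; split; last first.
    rewrite /= E2 subr_ge0 -sqr_enorm ler_sqr ?nnegrE ?enorm_ge0//; exact: ltW.
  by split; [exact: ltW|rewrite /= in_itv/= lexx ltW].
move: t0I; rewrite in_itv/= => /andP[t10' t02].
move=> /= Z0 Zpos.
have t0ge : 0 <= t0 := le_trans t10 t10'.
have E0gt : 0 < E x0 t0.
  rewrite lt_neqAle E0 andbT; apply/eqP => E0'; move: Z0; rewrite leNgt => /negP; apply.
  rewrite /P /psi -E0' expr0n/= mulr0 oppr0 add0r.
  by rewrite ltr_wpDl// wpos.
have t0gt : t1 < t0.
  rewrite lt_neqAle t10' andbT; apply/eqP => t0E; move: Z0; rewrite leNgt => /negP; apply.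
  rewrite -t0E; have E1 : E x0 t1 = del ^+ 2 - dotv (x0 - x1) (x0 - x1).
    by rewrite /E subrr mulr0 addr0.
  move: E0; rewrite -t0E E1 subr_ge0 -le_enormP ?(ltW del0)// => x0del.
  have wm : m < w x0 t1.
    apply: dm; exact: le_lt_trans (supnorm_le_enorm _) (le_lt_trans x0del deld).
  have : psi x0 t1 <= m.
    rewrite /psi subrr mulr0 expR0 mulr1 E1 /mu -mulrA ger_pMr// ler_pdivrMl ?exprn_gt0//.
    rewrite mulr1 (_ : 4 = 2 * 2)%N// exprM ler_sqr ?nnegrE ?exprn_ge0//.
    - by rewrite lerBlDr lerDl dotv_ge0.
    - by rewrite subr_ge0 -le_enormP ?(ltW del0).
    - exact: ltW.
  by have := Qgt0 x0 t1; rewrite /P; lra.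
have tgt0 : 0 < t0 := le_lt_trans t10 t0gt.
have [c cC hwc] := hw x0 t0 x0r tgt0.
pose q := x0 - x1.
have hpsi : heat_at psi x0 t0 (mu * expR (- kap * (t0 - t1)) *
    (- kap * E x0 t0 ^+ 2 + 2 * s * E x0 t0 - (8 * dotv q q - 4 * N%:R * E x0 t0))).
  have dexp := is_derive_expR_shift (- kap) mu t1 t0.
  have dE : is_derive t0 1 (E x0) s.
    have := is_derive_affine (del ^+ 2 - s * t1 - dotv q q) s t0.
    by rewrite (_ : (fun h => _) = E x0)//; apply/funext => h; rewrite /E; ring.
  have dE2 := is_derive_funM dE dE.
  have L := has_laplacianZ (mu * expR (- kap * (t0 - t1)))
    (has_laplacian_sqr_dotv x0 x1 (del ^+ 2 + s * (t0 - t1))).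
  eexists; eexists; split; [exact: (is_derive_funM dexp dE2)|exact: L|].
  by rewrite /= /q /E; ring.
have hP : heat_at P x0 t0 (-1 * (mu * expR (- kap * (t0 - t1)) *
    (- kap * E x0 t0 ^+ 2 + 2 * s * E x0 t0 - (8 * dotv q q - 4 * N%:R * E x0 t0)))
    + (eta * (C + 1) * expR ((C + 1) * (t0 - t1)))).
  have hQ := heat_at_separable (is_derive_expR_shift (C + 1) eta t1 t0) (has_laplacian_cst 1 x0).
  rewrite mulr0 subr0 mulr1 in hQ.
  have [d1 [l1 [D1 L1 E1]]] := hpsi.
  have hN : heat_at (fun x t => - psi x t) x0 t0 (-1 * (d1 - l1)).
    exists (- d1), (-1 * l1); split; last by ring.
      exact: is_deriveN.
    rewrite (_ : (fun y => - psi y t0) = (fun y => -1 * psi y t0)); first exact: has_laplacianZ.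
    by apply/funext => y; rewrite mulN1r.
  by have := heat_atD hN hQ; rewrite E1.
have [|Eq] := heat_at_touch cw cP hwc hP Z0.
- have nE : \forall z \near (x0, t0), 0 < E z.1 z.2.
    exact: (cvgr_gt (E x0 t0) (cE (x0, t0)) 0 E0gt).
  have nt : \forall z \near (x0, t0), t1 < z.2.
    exact: (cvgr_gt t0 (@cvg_snd _ _ (nbhs x0) (nbhs t0) _) t1 t0gt).
  near=> z; move=> zt0; apply: Zpos => //.
  have Ez : 0 < E z.1 z.2 by near: z.
  have tz : t1 < z.2 by near: z.
  have zt2 : z.2 <= t2 by apply: le_trans (ltW zt0) t02.
  split => /=; last exact: ltW.
  split => /=; last by rewrite in_itv/= ltW.
  rewrite le_enormP ?(ltW r0)//; move: Ez; rewrite /E subr_gt0 => /ltW/le_trans; apply.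
  rewrite -lerBrDl -(_ : s * (t2 - t1) = r ^+ 2 - del ^+ 2).
    by rewrite ler_pM2l// lerD2r.
  by rewrite /s divfK// subr_eq0 gt_eqF.
have -> : w x0 t0 = psi x0 t0 - Q eta x0 t0 by rewrite /P in Eq; lra.
apply/negP; rewrite -ltNge /psi /Q mulr1.
set k := expR (- kap * _); set k' := expR _; set y := E x0 t0.
have k0 : 0 < k by rewrite expR_gt0.
have k'0 : 0 < k' by rewrite expR_gt0.
have [cC1 cC2] : - C <= c /\ c <= C by move: cC; rewrite ler_norml => /andP.
have qE : del ^+ 2 - y <= dotv q q.
  rewrite /y /E -/q; have : 0 <= s * (t0 - t1) by rewrite mulr_ge0 ?subr_ge0// ltW.
  lra.
have d2 : 0 < del ^+ 2 by rewrite exprn_gt0.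
have h1 : 0 <= mu * k * ((c + kap) * y ^+ 2 - 2 * s * y + 8 * dotv q q - 4 * N%:R * y).
  apply: mulr_ge0; first by rewrite mulr_ge0// ltW.
  have sq : 0 <= 8 * del ^+ 2 * (a * y / (16 * del ^+ 2) - 1) ^+ 2.
    by rewrite mulr_ge0 ?sqr_ge0// mulr_ge0// ltW.
  rewrite (_ : 8 * del ^+ 2 * (a * y / (16 * del ^+ 2) - 1) ^+ 2 =
     a ^+ 2 / (32 * del ^+ 2) * y ^+ 2 - a * y + 8 * del ^+ 2) in sq; last first.
    by field; rewrite gt_eqF.
  have : 0 <= (c + C) * y ^+ 2 by rewrite mulr_ge0 ?sqr_ge0//; lra.
  rewrite /kap /a in sq *; lra.
have : 0 < eta * k' * (C + 1 - c) by rewrite !mulr_gt0//; lra.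
rewrite -subr_gt0.
lra.
Unshelve. all: by end_near. Qed.

End StrongMaximum.

(** Connectedness of the interval for a locally constant property, by its supremum. The local
    hypothesis does not ask for [Q s], so it covers openness and closedness at once. It serves to
    spread positivity, to move normals and to chain oscillation bounds. *)
Lemma unit_interval_induction (R : realType) (Q : R -> Prop) :
  Q 0 ->
  (forall s, 0 <= s <= 1 -> exists2 d, 0 < d & forall a b,
     `|a - s| < d -> `|b - s| < d -> 0 <= a <= 1 -> 0 <= b <= 1 -> Q a -> Q b) ->
  Q 1.
Proof.
move=> Q0 loc; pose S := [set s | 0 <= s <= 1 /\ Q s].
have S0 : S 0 by rewrite /S /= lexx ler01.
have hS : has_sup S by split; [exists 0|exists 1 => s [/andP[]]].
have sle s : S s -> s <= sup S by exact: (ub_le_sup hS.2).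
have s01 : 0 <= sup S <= 1.
  by rewrite sle//= ge_sup//; [exists 0|move=> s [/andP[]]].
have [d d0 loc'] := loc _ s01.
have [a [a01 Qa] sa] := sup_adherent d0 hS.
have das : `|a - sup S| < d by rewrite ler0_norm ?subr_le0 ?sle//; lra.
have [s1|s1] := leP 1 (sup S).
  have E : sup S = 1 by apply/eqP; rewrite eq_le s1 andbT; case/andP: s01.
  apply: (loc' a 1) => //; first by rewrite E subrr normr0.
  by rewrite ler01 lexx.
pose b := Num.min 1 (sup S + d / 2).
have sb : sup S < b by rewrite lt_min s1 ltrDl divr_gt0.
have b1 : b <= 1 by rewrite ge_min lexx.
have b01 : 0 <= b <= 1 by rewrite b1 andbT (le_trans _ (ltW sb))//; case/andP: s01.
have bd : b <= sup S + d / 2 by rewrite ge_min lexx orbT.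
have Qb : Q b by apply: (loc' a b) => //; rewrite gtr0_norm; lra.
by have := sle b (conj b01 Qb); rewrite leNgt sb.
Qed.

(** * Spreading positivity through the half domain *)

Section Connectedness.
Context {R : realType} {N : nat}.
Implicit Types (x y e : 'rV[R]_N) (D : set 'rV[R]_N) (w : 'rV[R]_N -> R -> R)
  (r s t c d C : R).

Lemma enorm_le_supnorm x : enorm x <= N%:R * `|x|.
Proof.
rewrite le_enormP ?mulr_ge0// exprMn.
apply: (@le_trans _ _ (N%:R * `|x| ^+ 2)).
  have -> : N%:R * `|x| ^+ 2 = \sum_(i < N) `|x| ^+ 2.
    by rewrite sumr_const card_ord mulr_natl.
  apply: ler_sum => i _; rewrite -expr2 -real_normK ?num_real// ler_sqr ?nnegrE//.
  exact: coord_le_supnorm.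
apply: ler_wpM2r; first exact: sqr_ge0.
by rewrite -natrX ler_nat; case: N => // n; rewrite expnS expn1 leq_pmulr.
Qed.

Lemma dotv_le_enorm x y : dotv x y <= enorm x * enorm y.
Proof.
have [->|y0] := eqVneq y 0; first by rewrite dotvC dotv0l mulr_ge0 ?enorm_ge0.
have [->|x0] := eqVneq x 0; first by rewrite dotv0l mulr_ge0 ?enorm_ge0.
have ny : 0 < enorm y by rewrite enorm_gt0.
have nx : 0 < enorm x by rewrite enorm_gt0.
have := dotv_ge0 ((enorm x)^-1 *: x - (enorm y)^-1 *: y).
rewrite !(dotvBl, dotvBr, dotvZl, dotvZr) -!sqr_enorm (dotvC y x).
rewrite (_ : _ - _ = 2 - 2 * (dotv x y / (enorm x * enorm y))); last first.
  by field; rewrite !gt_eqF.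
rewrite subr_ge0 -[leRHS]mulr1 ler_pM2l// ler_pdivrMr ?mulr_gt0//.
by rewrite mul1r.
Qed.

Lemma SigmaP (rad : R) x : Sigma N rad x <-> rad = 0 \/ rad < enorm x.
Proof.
rewrite /Sigma; case: eqP => [->|r0] /=; first by split => // _; left.
by split=> [|[]//]; right.
Qed.

Lemma Sigma_rad_le (rad : R) x : Sigma N rad x -> rad <= enorm x.
Proof. by move=> /SigmaP[->|/ltW//]; exact: enorm_ge0. Qed.

Lemma open_Sigma (rad : R) : open (Sigma N rad).
Proof.
rewrite /Sigma; case: eqP => _; [exact: openT|exact: open_enorm_gt].
Qed.

Section Positivity.
Variables (w : 'rV[R]_N -> R -> R) (D : set 'rV[R]_N) (T : R).
Hypotheses (cw : continuous (fun z => w z.1 z.2)) (oD : open D) (T0 : 0 < T)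
  (wT : forall x t, D x -> 0 <= t -> w x (t + T) = w x t)
  (w0 : forall x t, D x -> 0 <= t -> 0 <= w x t)
  (hw : forall r, exists2 C, 0 <= C & forall x t, D x -> enorm x <= r -> 0 < t ->
     exists2 c, `|c| <= C & heat_at w x t (c * w x t)).

Lemma periodic_iter x t n : D x -> 0 <= t -> w x (t + T *+ n) = w x t.
Proof.
move=> Dx t0; elim: n => [|n IH]; first by rewrite addr0.
by rewrite mulrSr addrA wT// addr_ge0// mulrn_wge0// ltW.
Qed.

(** The strong maximum principle only looks forward in time; adding enough periods to [t] puts it
    after the time of positivity, and periodicity brings the conclusion back. *)
Lemma positivity_ball x : D x -> exists2 d, 0 < d & forall y z,
  `|y - x| < d -> `|z - x| < d -> (exists2 t, 0 <= t & 0 < w y t) ->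
  forall t, 0 <= t -> 0 < w z t.
Proof.
move=> Dx; have /nbhs_ballP[rho /= rho0 rhoD] := open_nbhs_nbhs (conj oD Dx).
have inD y : `|y - x| < rho -> D y by move=> yx; apply: rhoD; rewrite -ball_normE/= distrC.
(* Neighbourhoods are balls of the sup norm, and the Euclidean norm is at most [N] times it:
   [2 d N < rho / 2] places [z] in the Euclidean ball about [y], which itself stays in [D]. *)
pose d := rho / (4 * (N%:R + 1)).
have N1 : 0 < N%:R + 1 :> R by rewrite ltr_wpDl.
have d0 : 0 < d by rewrite divr_gt0// mulr_gt0.
have dE : 4 * d * N%:R + 4 * d = rho by rewrite /d; field; rewrite gt_eqF.
have dN0 : 0 <= d * N%:R by rewrite mulr_ge0// ltW.
exists d => // y z yx zx [t1 t10 wy] t t0.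
have ballD v : enorm (v - y) <= rho / 2 -> `|v - x| < rho.
  move=> vy; rewrite -(subrK y v) -addrA (le_lt_trans (ler_normD _ _))//.
  have := le_trans (supnorm_le_enorm (v - y)) vy; lra.
have [C C0 hC] := hw (N%:R * (`|x| + rho)).
have zy : enorm (z - y) < rho / 2.
  apply: (le_lt_trans (enorm_le_supnorm _)).
  have : `|z - y| <= 2 * d.
    rewrite -(subrK x z) -addrA (le_trans (ler_normD _ _))// [`|x - y|]distrC; lra.
  by move=> /(ler_wpM2l (ler0n R N)) h; lra.
have [n tn] : exists n, t1 < t + T *+ n.
  have := archi_boundP (divr_ge0 t10 (ltW T0)); set n := Num.bound _.
  rewrite ltr_pdivrMr// => tn; exists n; rewrite -mulr_natl.
  by apply: (lt_le_trans tn); rewrite lerDr.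
rewrite -(periodic_iter n)//; last first.
  by apply/inD; lra.
apply: (@positivity_spreads _ _ w y (rho / 2) C t1) => //.
- by rewrite divr_gt0.
- by move=> v s /ballD/inD Dv s0; exact: w0.
- move=> v s vy s0; apply: hC => //; first exact/inD/ballD.
  apply: le_trans (enorm_le_supnorm _) _; apply: ler_wpM2l => //.
  by rewrite -[v](subrK x) (le_trans (ler_normD _ _))// addrC lerD2l ltW// ballD.
Qed.

Lemma positivity_segment x y :
  (forall s, 0 <= s <= 1 -> D (x + s *: (y - x))) ->
  (exists2 t, 0 <= t & 0 < w x t) -> forall t, 0 <= t -> 0 < w y t.
Proof.
move=> seg [t1 t10 wx].
suff : (fun s => exists2 t, 0 <= t & 0 < w (x + s *: (y - x)) t) 1.
  rewrite scale1r addrC subrK => -[t2 t20 wy].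
  have Dy : D y by have := seg 1; rewrite scale1r addrC subrK; apply; rewrite ler01 lexx.
  have [d d0 pos] := positivity_ball Dy.
  by apply: (pos y y); rewrite ?subrr ?normr0//; exists t2.
apply: (unit_interval_induction
  (Q := fun s => exists2 t, 0 <= t & 0 < w (x + s *: (y - x)) t)).
  by exists t1; rewrite // scale0r addr0.
move=> s s01; have [d d0 pos] := positivity_ball (seg s s01).
have k0 : 0 < `|y - x| + 1 by rewrite ltr_wpDl.
have close a : `|a - s| < d / (`|y - x| + 1) ->
    `|x + a *: (y - x) - (x + s *: (y - x))| < d.
  rewrite ltr_pdivlMr// => ad; rewrite opprD addrACA subrr add0r -scalerBl normrZ.
  by apply: le_lt_trans ad; apply: ler_wpM2l => //; rewrite lerDl.
exists (d / (`|y - x| + 1)); first by rewrite divr_gt0.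
move=> a b /close ad /close bd _ _ wa; exists 0 => //.
exact: pos ad bd wa _ _.
Qed.

End Positivity.

Definition half_Sigma (rad : R) e : set 'rV[R]_N := [set x | Sigma N rad x /\ 0 < dotv x e].

Lemma open_half_Sigma rad e : open (half_Sigma rad e).
Proof. by apply: openI; [exact: open_Sigma|exact: open_dotv_gt]. Qed.

Lemma half_SigmaZ rad e x k : 1 <= k -> half_Sigma rad e x -> half_Sigma rad e (k *: x).
Proof.
move=> k1 [/SigmaP Sx xe]; have k0 : 0 < k by lra.
split; last by rewrite dotvZl mulr_gt0.
apply/SigmaP; case: Sx => [->|rx]; [by left|right].
by rewrite enormZ gtr0_norm// (lt_le_trans rx)// ler_peMl// enorm_ge0.
Qed.

(** The half domain is not convex when a ball is removed. The path dilates [x] to [L x], goes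
    straight to [L y] and shrinks back to [y]; by the choice of [L] the middle segment has height at
    least [L m > rad |e|] along [e], so by Cauchy-Schwarz it avoids the ball. *)
Lemma positivity_half_Sigma rad w e T x y : 0 <= rad -> e != 0 ->
  continuous (fun z => w z.1 z.2) -> 0 < T ->
  (forall x t, half_Sigma rad e x -> 0 <= t -> w x (t + T) = w x t) ->
  (forall x t, half_Sigma rad e x -> 0 <= t -> 0 <= w x t) ->
  (forall r, exists2 C, 0 <= C & forall x t, half_Sigma rad e x -> enorm x <= r ->
     0 < t -> exists2 c, `|c| <= C & heat_at w x t (c * w x t)) ->
  half_Sigma rad e x -> half_Sigma rad e y ->
  (exists2 t, 0 <= t & 0 < w x t) -> forall t, 0 <= t -> 0 < w y t.
Proof.
move=> rad0 e0 cw T0 wT w0 hw Dx Dy wx.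
have step := positivity_segment cw (@open_half_Sigma rad e) T0 wT w0 hw.
pose m := Num.min (dotv x e) (dotv y e).
have m0 : 0 < m by rewrite lt_min Dx.2 Dy.2.
have e0' : 0 < enorm e by rewrite enorm_gt0.
pose L := 1 + rad * enorm e / m.
have L1 : 1 <= L by rewrite lerDl divr_ge0 ?mulr_ge0// ltW.
have ex z : (forall t, 0 <= t -> 0 < w z t) -> exists2 t, 0 <= t & 0 < w z t.
  by move=> h; exists 0; rewrite // h.
apply: (step (L *: y) y) => [s s01|].
  rewrite (_ : L *: y + _ = (L - s * (L - 1)) *: y).
    by apply: half_SigmaZ => //; nra.
  by apply/rowP => i; rewrite !mxE; ring.
apply/ex/(step (L *: x)) => [s s01|].
  rewrite (_ : L *: x + _ = L *: (x + s *: (y - x))); last first.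
    by apply/rowP => i; rewrite !mxE; ring.
  have mp : m <= dotv (x + s *: (y - x)) e.
    have hx : m <= dotv x e by rewrite ge_min lexx.
    have hy : m <= dotv y e by rewrite ge_min lexx orbT.
    by rewrite dotvDl dotvZl dotvBl; nra.
  have L0 : 0 < L by lra.
  split; last by rewrite dotvZl mulr_gt0//; lra.
  apply/SigmaP; right; rewrite -(ltr_pM2r e0').
  apply: lt_le_trans (dotv_le_enorm _ _); rewrite dotvZl.
  apply: (@lt_le_trans _ _ (L * m)); last by rewrite ler_pM2l.
  by rewrite /L mulrDl divfK ?gt_eqF// mul1r ltrDr.
apply/ex/(step x) => // s s01.
rewrite (_ : x + _ = (1 + s * (L - 1)) *: x).
  by apply: half_SigmaZ => //; nra.
by apply/rowP => i; rewrite !mxE; ring.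
Qed.

End Connectedness.

(** * A weight decaying in mean *)

Section TimeWeight.
Context {R : realType}.
Implicit Types (A : set R) (s t : R).

Definition occupation A t : R := fine (lebesgue_measure (A `&` `[0, t])).

Lemma measurable_occupation A t : open A -> measurable (A `&` `[0, t]).
Proof.
by move=> oA; apply: measurableI; [exact: measurable_realfun.open_measurable|exact: measurable_itv].
Qed.

Lemma lebesgue_measure_seg_lty s t : (lebesgue_measure (`[s, t]%classic : set R) < +oo)%E.
Proof. by rewrite lebesgue_measure_itv; case: ifP => _; rewrite ?ltry. Qed.

Lemma lebesgue_measure_oc s t : s <= t ->
  lebesgue_measure (`]s, t]%classic : set R) = (t - s)%:E.
Proof.
move=> st; rewrite lebesgue_measure_itv/= lte_fin; case: ifPn => // /negP/negP.
by rewrite -leNgt => ts; rewrite (_ : t = s) ?subrr//; apply/eqP; rewrite eq_le ts.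
Qed.

Lemma lebesgue_measure_occupation_fin A t : open A ->
  lebesgue_measure (A `&` `[0, t]) \is a fin_num.
Proof.
move=> oA; rewrite ge0_fin_numE//; apply: le_lt_trans (lebesgue_measure_seg_lty 0 t).
by apply: le_measure; rewrite ?inE;
    [exact: measurable_occupation|exact: measurable_itv|exact: subIsetr].
Qed.

Lemma occupation_le A s t : open A -> s <= t -> occupation A s <= occupation A t.
Proof.
move=> oA st; apply: fine_le; try exact: lebesgue_measure_occupation_fin.
apply: le_measure; rewrite ?inE; try exact: measurable_occupation.
apply: setIS => x /=; rewrite !in_itv/= => /andP[-> /=].
by move=> /le_trans; apply.
Qed.

Lemma occupation_lip A s t : open A -> s <= t ->
  occupation A t <= occupation A s + (t - s).
Proof.
move=> oA st; rewrite -lee_fin EFinD /occupation !fineK ?lebesgue_measure_occupation_fin//.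
rewrite -lebesgue_measure_oc//.
apply: le_trans (measureU2 _ _ _); [|exact: measurable_occupation|exact: measurable_itv].
apply: le_measure; rewrite ?inE; first exact: measurable_occupation.
  by apply: measurableU; [exact: measurable_occupation|exact: measurable_itv].
move=> x [Ax] /=; rewrite !in_itv/= => /andP[x0 xt].
by have [xs|sx] := leP x s; [left|right]; rewrite ?x0 ?sx ?xt.
Qed.

Lemma occupation_increase A s t : open A -> 0 <= s -> s <= t -> `]s, t] `<=` A ->
  occupation A t = occupation A s + (t - s).
Proof.
move=> oA s0 st stA; apply/EFin_inj; rewrite EFinD /occupation.
rewrite !fineK ?lebesgue_measure_occupation_fin// -lebesgue_measure_oc//.
rewrite -measureU//; [|exact: measurable_occupation|].
  congr (lebesgue_measure _); apply/seteqP; split => x.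
    move=> [Ax] /=; rewrite !in_itv/= => /andP[x0 xt].
    by have [xs|sx] := leP x s; [left|right]; rewrite ?x0 ?sx ?xt.
  move=> [[Ax] /=|xst]; rewrite ?in_itv/=.
    by move=> /andP[x0 xs]; split => //; rewrite x0 (le_trans xs).
  split; first exact: stA.
  by move: xst; rewrite /= !in_itv/= => /andP[sx ->]; rewrite (le_trans s0 (ltW sx)).
apply/seteqP; split => // x [[Ax] /=]; rewrite !in_itv/= => /andP[_ xs] /andP[].
by rewrite ltNge xs.
Qed.

Lemma occupation0 A : open A -> occupation A 0 = 0.
Proof.
move=> oA; apply/eqP; rewrite eq_le fine_ge0// andbT -lee_fin /occupation.
rewrite fineK ?lebesgue_measure_occupation_fin//.
apply: (@le_trans _ _ (lebesgue_measure (`[0, 0]%classic : set R))).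
  by apply: le_measure; rewrite ?inE;
    [exact: measurable_occupation|exact: measurable_itv|exact: subIsetr].
by rewrite lebesgue_measure_itv/= ltxx.
Qed.

Lemma continuous_occupation A : open A -> continuous (occupation A).
Proof.
move=> oA t; apply/cvgrPdist_le => eps eps0; near=> s.
have : `|t - s| <= eps.
  by near: s; apply: (cvgr_dist_le (FF := nbhs_filter t) id t); exact: cvg_id || exact: eps0.
by case: (leP s t) => [|/ltW] st;
  have := occupation_le oA st; have := occupation_lip oA st; rewrite !ler_norml; lra.
Unshelve. all: by end_near. Qed.

(* A point of [A n] costs the growth rate [k], but [A n] takes up little time. *)
Lemma decaying_weight (A : nat -> set R) (T g k : R) :
  0 < T -> 0 < g -> 0 <= k ->
  (forall n, open (A n)) -> (forall n, A n.+1 `<=` A n) ->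
  (forall t, 0 <= t -> exists n, ~ A n t) ->
  exists n (b : R -> R), [/\ continuous b, forall t, 0 <= b t, b 0 = 1, b T < 1 &
    forall t, 0 < t -> exists lam,
      (\forall s \near t, s < t -> b s <= b t * expR (lam * (s - t))) /\
      (lam = k - g \/ lam = - g /\ ~ A n t)].
Proof.
move=> T0 g0 k0 oA decA outA.
(* The sets decrease to the empty set within [[0, T]], so their measures tend to 0 by continuity
   from above. *)
have [n nsmall] : exists n, k * occupation (A n) T < g * T.
  have cv : occupation (A n) T @[n --> \oo] --> 0.
    apply: fine_cvg; pose F n := A n `&` `[0, T].
    have F0 : \bigcap_n F n = set0.
      apply/seteqP; split => // t Ft.
      have t0 : 0 <= t by have [_] := Ft 0%N I; rewrite /= in_itv/= => /andP[].
      by have [n nA] := outA t t0; apply: nA; have [] := Ft n I.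
    have := @nonincreasing_cvg_mu _ _ _ (@lebesgue_measure R) F.
    rewrite F0 measure0; apply => //.
    - by rewrite -ge0_fin_numE//; exact: lebesgue_measure_occupation_fin.
    - by move=> i; exact: measurable_occupation.
    - apply/nonincreasing_seqP => i; apply/subsetPset; exact: setSI.
  have : k * occupation (A n) T @[n --> \oo] --> k * 0.
    by apply: cvgM => //; exact: cvg_cst.
  rewrite mulr0 => /(cvgr_lt 0)/(_ _ (mulr_gt0 g0 T0)) [m _ /(_ m (leqnn m))].
  by exists m.
pose b t := expR (- (g * t) + k * occupation (A n) t).
exists n, b; split.
- move=> t; apply: (@continuous_comp _ _ _ (fun t => - (g * t) + k * occupation (A n) t) expR).
    apply: cvgD; first by apply: cvgN; apply: cvgM; [exact: cvg_cst|exact: cvg_id].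
    by apply: cvgM; [exact: cvg_cst|exact: continuous_occupation].
  exact: continuous_expR.
- by move=> t; exact: expR_ge0.
- by rewrite /b occupation0// !mulr0 oppr0 addr0 expR0.
- by rewrite /b -expR0 ltr_expR; lra.
(* Inside the open set the occupation time grows at unit rate, so [b] has exact rate [k - g].
   Outside it, even at a boundary point, monotonicity of the occupation time gives the bound for
   earlier times. *)
move=> t t0; have [At|nAt] := pselect (A n t).
  exists (k - g); split; last by left.
  have /nbhs_ballP[d /= d0 dA] := open_nbhs_nbhs (conj (oA n) At).
  near=> s; move=> st.
  have s0 : 0 < s by near: s; exact: lt_nbhsr.
  have sd : t - d < s by near: s; apply: lt_nbhsr; lra.
  rewrite /b -expRD ler_expR (@occupation_increase _ s t)//; [|exact: ltW..|].
    lra.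
  move=> x; rewrite /= in_itv/= => /andP[sx xt]; apply: dA.
  by rewrite -ball_normE/= ger0_norm ?subr_ge0//; lra.
exists (- g); split; last by right.
near=> s; move=> st; rewrite /b -expRD ler_expR.
by have := ler_wpM2l k0 (occupation_le (oA n) (ltW st)); lra.
Unshelve. all: by end_near. Qed.

End TimeWeight.

(** * The barrier in space *)

Section Barrier.
Context {R : realType} {N : nat}.
Variable rad : R.
Implicit Types (x e : 'rV[R]_N) (L : R).

Definition closed_half e : set 'rV[R]_N := [set x | rad <= enorm x /\ 0 <= dotv x e].

Lemma closed_closed_half e : closed (closed_half e).
Proof.
apply: closedI; last exact: closed_dotv_ge.
apply: (@preimage_closed _ _ (@enorm R N) [set y | rad <= y]); last exact: closed_ge.
by move=> x _; exact: continuous_enorm.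
Qed.

(* [theta] drops the boundary term when [rad = 0]. *)
Let theta : R := (rad != 0)%:R.

(** For large [L] each exponential has a huge Laplacian in a layer of thickness about [1 / L], along
    the hyperplane and along the sphere respectively. The constant 3 keeps the values between 1 and
    3. *)
Definition barrier L e x : R :=
  3 + (-1 * expR (- (L * dotv x e)) + - theta * expR (- (L * (dotv x x - rad ^+ 2)))).

(* The part of the half domain where positivity survives small rotations by
   compactness; elsewhere the barrier takes over. *)
Definition core L (kR : R) e x := [/\ L^-1 <= dotv x e,
  theta * (rad ^+ 2 + L^-1) <= theta * dotv x x & enorm x <= kR].

Let theta01 : theta = 0 \/ theta = 1.
Proof. by rewrite /theta; case: eqP => _; [left|right]. Qed.

Lemma core_half_Sigma L kR e x : 0 <= rad -> 0 < L -> core L kR e x -> half_Sigma rad e x.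
Proof.
move=> rad0 L0 [Lx thx _]; have Li : 0 < L^-1 by rewrite invr_gt0.
split; last by lra.
apply/SigmaP; have [r0|r0] := eqVneq rad 0; [by left|right].
rewrite -ltr_sqr ?nnegrE ?enorm_ge0// sqr_enorm.
by move: thx; rewrite /theta r0 !mul1r; lra.
Qed.

Lemma barrier_itv L e x : 0 <= rad -> 0 <= L -> closed_half e x -> 1 <= barrier L e x <= 3.
Proof.
move=> rad0 L0 [rx xe]; rewrite /barrier.
have e1 : 0 < expR (- (L * dotv x e)) <= 1.
  by rewrite expR_gt0 -[leRHS]expR0 ler_expR oppr_le0 mulr_ge0.
have e2 : 0 < expR (- (L * (dotv x x - rad ^+ 2))) <= 1.
  rewrite expR_gt0 -[leRHS]expR0 ler_expR oppr_le0 mulr_ge0//.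
  by rewrite subr_ge0 -ge_enormP.
by case: theta01 => ->; apply/andP; split; lra.
Qed.

Lemma continuous_barrier L e : continuous (barrier L e).
Proof.
move=> x; have cd : dotv y y @[y --> x] --> dotv x x.
  by apply: (@cvg_dotv _ _ _ (nbhs x) _ id id); exact: cvg_id.
have c1 : expR (- (L * dotv y e)) @[y --> x] --> expR (- (L * dotv x e)).
  exact: (cvg_comp _ _ (cvgN (cvgM (cvg_cst L) (@continuous_dotvl _ _ e x)))
    (@continuous_expR _ _)).
have c2 : expR (- (L * (dotv y y - rad ^+ 2))) @[y --> x] --> expR (- (L * (dotv x x - rad ^+ 2))).
  exact: (cvg_comp _ _ (cvgN (cvgM (cvg_cst L) (cvgB cd (cvg_cst (rad ^+ 2)))))
    (@continuous_expR _ _)).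
exact: (cvgD (cvg_cst _) (cvgD (cvgM (cvg_cst _) c1) (cvgM (cvg_cst _) c2))).
Qed.

(** [m] stands for a lower bound of [|e|^2] valid for all normals near the given one, so one [L]
    serves them all. The factor [expR (-1)] is the least value of the exponentials in their layers,
    and [3 * K] dominates [K] times the barrier. The condition on [N] makes the first order part of
    the spherical Laplacian at most half of the leading part. *)
Lemma barrier_parameter (K m : R) : 0 <= K -> 0 < m -> exists L, [/\ 1 <= L,
  3 * K <= L ^+ 2 * m * expR (-1) &
  rad != 0 -> N%:R <= L * rad ^+ 2 /\ 3 * K <= 2 * L ^+ 2 * rad ^+ 2 * expR (-1)].
Proof.
move=> K0 m0; set a := m * expR (-1); set b := 2 * rad ^+ 2 * expR (-1).
have ei0 : 0 < expR (-1) :> R by exact: expR_gt0.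
have a0 : 0 < a by rewrite mulr_gt0.
have b0 : 0 <= b by rewrite mulr_ge0 ?(ltW ei0)// mulr_ge0// sqr_ge0.
have p1 : 0 <= 3 * K / a by rewrite divr_ge0 ?(ltW a0)// mulr_ge0.
have p2 : 0 <= N%:R / rad ^+ 2 by rewrite divr_ge0// sqr_ge0.
have p3 : 0 <= 3 * K / b by rewrite divr_ge0// mulr_ge0.
(* If [rad = 0], the last two denominators are 0 and these quotients are 0. *)
pose L := 1 + (3 * K / a + (N%:R / rad ^+ 2 + 3 * K / b)).
have [L1 La [Lr Lb]] : [/\ 1 <= L, 3 * K / a <= L & N%:R / rad ^+ 2 <= L /\ 3 * K / b <= L].
  by rewrite /L; split; [|lra|split]; lra.
have LL : L <= L ^+ 2 by rewrite expr2 ler_peMl//; lra.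
exists L; split => //.
  by move: (le_trans La LL); rewrite ler_pdivrMr// /a mulrA.
move=> r0; have r20 : 0 < rad ^+ 2 by rewrite lt_neqAle sqr_ge0 andbT eq_sym sqrf_eq0.
split; first by move: Lr; rewrite ler_pdivrMr.
have b0' : 0 < b by rewrite mulr_gt0// mulr_gt0.
move: (le_trans Lb LL); rewrite ler_pdivrMr// => /le_trans; apply.
by rewrite (_ : L ^+ 2 * b = 2 * L ^+ 2 * rad ^+ 2 * expR (-1)); [|rewrite /b; ring].
Qed.

Lemma has_laplacian_barrier L e x : has_laplacian (barrier L e) x
  (- (L ^+ 2 * dotv e e * expR (- (L * dotv x e)))
   - theta * ((4 * L ^+ 2 * dotv x x - 2 * L * N%:R) * expR (- (L * (dotv x x - rad ^+ 2))))).
Proof.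
have := has_laplacianD (has_laplacian_cst 3 x) (has_laplacianD
  (has_laplacianZ (-1) (has_laplacian_expR_linear x e L))
  (has_laplacianZ (- theta) (has_laplacian_expR_dotv x L (rad ^+ 2)))).
by congr (has_laplacian _ _ _); ring.
Qed.

(** Both exponential terms contribute nonpositively everywhere. A point off the core but within
    radius [kR] lies in one of the two layers, where the corresponding term alone reaches
    [- 3 K]. *)
Lemma barrier_superharmonic L (K m : R) e x : 0 <= rad -> 1 <= L -> 0 <= K -> 0 < m ->
  m <= dotv e e -> 3 * K <= L ^+ 2 * m * expR (-1) ->
  (rad != 0 -> N%:R <= L * rad ^+ 2 /\ 3 * K <= 2 * L ^+ 2 * rad ^+ 2 * expR (-1)) ->
  half_Sigma rad e x ->
  exists l, [/\ has_laplacian (barrier L e) x l, l <= 0 &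
    forall kR, ~ core L kR e x -> enorm x <= kR -> l <= - (3 * K)].
Proof.
move=> rad0 L1 K0 m0 me hK hth [/SigmaP Sx xe].
have L0 : 0 < L by lra.
have L2 : 0 < L ^+ 2 by rewrite exprn_gt0.
have rx : rad ^+ 2 <= dotv x x.
  by rewrite -ge_enormP//; case: Sx => [->|/ltW//]; exact: enorm_ge0.
have := has_laplacian_barrier L e x.
set E1 := expR (- (L * dotv x e)); set E2 := expR (- (L * (_ - _))) => hl.
have E10 : 0 < E1 by rewrite expR_gt0.
have E20 : 0 < E2 by rewrite expR_gt0.
have t1 : 0 <= L ^+ 2 * dotv e e * E1.
  by rewrite mulr_ge0 ?(ltW E10)// mulr_ge0 ?dotv_ge0// ltW.
have r20 : 0 <= 2 * L ^+ 2 * rad ^+ 2.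
  by rewrite mulr_ge0 ?sqr_ge0// mulr_ge0// ltW.
have t2 : 0 <= theta * (2 * L ^+ 2 * rad ^+ 2 * E2) <=
    theta * ((4 * L ^+ 2 * dotv x x - 2 * L * N%:R) * E2).
  have [r0|r0] := eqVneq rad 0; first by rewrite /theta r0 eqxx /= !mul0r lexx.
  rewrite /theta r0 !mul1r mulr_ge0 ?(ltW E20)//=.
  apply: (ler_wpM2r (ltW E20)); have [hN _] := hth r0.
  have := ler_wpM2l (ltW L0) hN; have := ler_wpM2l (ltW L2) rx; lra.
exists (- (L ^+ 2 * dotv e e * E1) - theta * ((4 * L ^+ 2 * dotv x x - 2 * L * N%:R) * E2)).
split; [exact: hl|by lra|].
move=> kR ncore xk.
have em1 z : z <= L^-1 -> expR (-1) <= expR (- (L * z)).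
  by move=> zL; rewrite ler_expR lerN2 -(mulfV (lt0r_neq0 L0)) ler_pM2l.
have [xL|xL] := leP (dotv x e) L^-1.
  have : L ^+ 2 * m * expR (-1) <= L ^+ 2 * dotv e e * E1.
    apply: ler_pM; [|exact: expR_ge0| |exact: em1].
      by rewrite mulr_ge0// ltW.
    by rewrite ler_pM2l.
  by lra.
have [r0|r0] := eqVneq rad 0.
  by exfalso; apply: ncore; split; rewrite /theta ?r0 ?eqxx/= ?mul0r// ltW.
have [_ hK2] := hth r0.
have xL2 : dotv x x - rad ^+ 2 <= L^-1.
  rewrite leNgt; apply/negP => h; apply: ncore; split => //; first exact: ltW.
  by rewrite /theta r0 !mul1r; lra.
have : 2 * L ^+ 2 * rad ^+ 2 * expR (-1) <= 2 * L ^+ 2 * rad ^+ 2 * E2.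
  by apply: ler_wpM2l => //; exact: em1.
by move: t2; rewrite /theta r0 !mul1r; lra.
Qed.

End Barrier.

(** * Rotating planes *)

Definition reflection_gap (R : realType) (N : nat) (U : 'rV[R]_N -> R -> R)
  (e x : 'rV[R]_N) (t : R) : R := U x t - U (refl e x) t.

Section RotatingPlanes.
Context {R : realType} {N : nat}.
Variables (rad : R) (U : 'rV[R]_N -> R -> R) (f fu : R -> R -> R -> R).
Variables (M0 T C rho gam eps : R).
Implicit Types (x y e p : 'rV[R]_N) (t s r a b c : R).
Local Notation W := (reflection_gap U).
Local Notation closed_half := (closed_half rad).
Hypotheses (hN : (0 < N)%N) (rad0 : 0 <= rad) (T0 : 0 < T) (C0 : 0 <= C)
  (gam0 : 0 < gam) (eps0 : 0 < eps).
Hypothesis cU : continuous (fun z => U z.1 z.2).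
Hypothesis UB : forall x t, `|U x t| <= M0.
Hypothesis UT : forall x t, 0 <= t -> U x (t + T) = U x t.
Hypothesis Uout : forall x t, ~ Sigma N rad x -> U x t = 0.
Hypothesis Udecay : forall t d, 0 <= t -> 0 < d ->
  exists M : R, forall x, M < enorm x -> `|U x t| < d.
(** The mean value form makes the gap equation linear. Comparison on the unbounded domain uses the
    upper bound [fuC], valid at all radii; the strong maximum principle uses the two-sided bound
    [fu_loc], local in the radius. *)
Hypothesis fmvt : forall t r a b, 0 < t -> rad <= r -> exists xi,
  [/\ Num.min a b <= xi, xi <= Num.max a b & f t r a - f t r b = fu t r xi * (a - b)].
Hypothesis fuC : forall t r s, 0 < t -> rad <= r -> `|s| <= M0 -> fu t r s <= C.
Hypothesis fu_loc : forall r1, exists2 C1, 0 <= C1 &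
  forall t r s, 0 < t -> rad <= r -> r <= r1 -> `|s| <= M0 -> `|fu t r s| <= C1.
Hypothesis fu_neg : forall t r s, 0 < t -> rad <= r -> rho < r -> `|s| < eps ->
  fu t r s < - gam.
Hypothesis heatW : forall e x t, e != 0 -> Sigma N rad x -> 0 < t ->
  heat_at (W e) x t (f t (enorm x) (U x t) - f t (enorm x) (U (refl e x) t)).

Lemma cvg_gap (I : Type) (F : set_system I) {FF : Filter F}
    (ee xx : I -> 'rV[R]_N) (tt : I -> R) e x t : e != 0 ->
  ee @ F --> e -> xx @ F --> x -> tt @ F --> t ->
  (fun i => W (ee i) (xx i) (tt i)) @ F --> W e x t.
Proof.
move=> e0 He Hx Ht; apply: cvgB; apply: cvg_uncurry => //.
exact: cvg_refl.
Qed.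

Lemma continuous_gap e : e != 0 -> continuous (fun z => W e z.1 z.2).
Proof. by move=> e0 z; apply: cvg_gap => //; [exact: cvg_cst|exact: cvg_fst|exact: cvg_snd]. Qed.

Lemma gap_bound e x t : `|W e x t| <= 2 * M0.
Proof. by apply: le_trans (ler_normB _ _) _; rewrite mulrDl mul1r lerD. Qed.

Lemma gap_periodic e x t : 0 <= t -> W e x (t + T) = W e x t.
Proof. by move=> t0; rewrite /reflection_gap !UT. Qed.

Lemma Sigma_refl e x : e != 0 -> Sigma N rad (refl e x) <-> Sigma N rad x.
Proof. by move=> e0; rewrite !SigmaP enorm_refl. Qed.

Lemma gap_out e x t : e != 0 -> ~ Sigma N rad x -> W e x t = 0.
Proof.
by move=> e0 Sx; rewrite /reflection_gap !Uout ?subrr// => /(Sigma_refl _ e0).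
Qed.

Lemma gap_refl e x t : e != 0 -> W e (refl e x) t = - W e x t.
Proof. by move=> e0; rewrite /reflection_gap reflK// opprB. Qed.

(** The intermediate value [xi] lies between the two values of [U], so it inherits any bound they
    share; the last clause is what lets [fu_neg] apply far out. *)
Lemma gap_equation e x t : e != 0 -> Sigma N rad x -> 0 < t -> exists xi,
  [/\ heat_at (W e) x t (fu t (enorm x) xi * W e x t), `|xi| <= M0 &
    forall d, `|U x t| < d -> `|U (refl e x) t| < d -> `|xi| < d].
Proof.
move=> e0 Sx t0.
have [xi [xi1 xi2 E]] := fmvt (U x t) (U (refl e x) t) t0 (Sigma_rad_le Sx).
exists xi; split; first by rewrite -E; exact: heatW.
  move: xi1 xi2; rewrite ge_min le_max ler_norml.
  have := UB x t; have := UB (refl e x) t; rewrite !ler_norml.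
  by move=> /andP[? ?] /andP[? ?] /orP[?|?] /orP[?|?]; apply/andP; split; lra.
move=> d; rewrite !ltr_norml => /andP[? ?] /andP[? ?].
move: xi1 xi2; rewrite ge_min le_max.
by move=> /orP[?|?] /orP[?|?]; apply/andP; split; lra.
Qed.

Lemma half_Sigma_closed_half e : half_Sigma rad e `<=` closed_half e.
Proof. by move=> x [/Sigma_rad_le Sx /ltW]. Qed.

Lemma gap_boundary e x t : e != 0 -> closed_half e x -> ~ half_Sigma rad e x -> 0 <= W e x t.
Proof.
move=> e0 [rx xe] nD; have [Sx|/(gap_out t e0) ->//] := pselect (Sigma N rad x).
rewrite /reflection_gap refl_fix ?subrr//; apply/eqP; rewrite eq_le xe andbT leNgt.
by apply/negP => xe'; exact: nD.
Qed.

Lemma gap_ge0_initial e : e != 0 ->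
  (forall x, closed_half e x -> 0 <= W e x 0) ->
  forall x t, closed_half e x -> 0 <= t -> 0 <= W e x t.
Proof.
move=> e0 w0 x t Hx t0.
suff : - (0 * 1 * 0) <= W e x t by rewrite !mul0r oppr0.
(* With zero weight the comparison is the weak maximum principle. *)
apply: (@comparison_unbounded _ _ (W e) (half_Sigma rad e) (closed_half e)
  (fun=> 0) (fun=> 1) (2 * M0) C 0 t) => //.
- exact: continuous_gap.
- by move=> *; exact: gap_bound.
- exact: open_half_Sigma.
- exact: closed_closed_half.
- exact: half_Sigma_closed_half.
- exact: cst_continuous.
- exact: cst_continuous.
- by move=> y s Hy nDy _; exact: gap_boundary.
- by move=> y Hy; rewrite mul0r oppr0; exact: w0.
move=> y s [Sy ye] s0 _; right.
have [xi [h xiM _]] := gap_equation e0 Sy s0.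
exists (fu s (enorm y) xi); split => //; first by apply: fuC => //; exact: Sigma_rad_le.
exists 0, 0; split; first exact: has_laplacian_cst.
  by near=> q; move=> _; rewrite mul0r expR0 mulr1.
by rewrite !mulr0 subrr subr0.
Unshelve. all: by end_near. Qed.

Definition positive_direction e :=
  e != 0 /\ forall x t, half_Sigma rad e x -> 0 <= t -> 0 < W e x t.

Lemma gap_positive e x0 : e != 0 ->
  (forall x t, half_Sigma rad e x -> 0 <= t -> 0 <= W e x t) ->
  half_Sigma rad e x0 -> 0 < W e x0 0 -> positive_direction e.
Proof.
move=> e0 w0 Dx0 wx0; split => // x t Dx t0.
have wT y s : half_Sigma rad e y -> 0 <= s -> W e y (s + T) = W e y s.
  by move=> _; exact: gap_periodic.
have cw := continuous_gap e0.
apply: (positivity_half_Sigma rad0 e0 cw T0 wT w0 _ Dx0 Dx) => //; last by exists 0.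
move=> r; have [C1 C10 hC1] := fu_loc r; exists C1 => // y s [Sy ye] yr s0.
have [xi [h xiM _]] := gap_equation e0 Sy s0.
by exists (fu s (enorm y) xi) => //; apply: hC1 => //; exact: Sigma_rad_le.
Qed.

Lemma half_Sigma_neq0 e : e != 0 -> exists x, half_Sigma rad e x.
Proof.
move=> e0; have ee : 0 < enorm e by rewrite enorm_gt0.
have k0 : 0 < (rad + 1) / enorm e by rewrite divr_gt0// ltr_wpDl.
exists (((rad + 1) / enorm e) *: e); split; last by rewrite dotvZl mulr_gt0// dotv_gt0.
by apply/SigmaP; right; rewrite enormZ gtr0_norm// divfK ?gt_eqF// ltrDl.
Qed.

Lemma positive_direction_open e1 : positive_direction e1 ->
  \forall e \near e1, positive_direction e.
Proof.
move=> [e10 pos1].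
(* These are the bad times: strict inequalities make them open, since a witness [x] persists, and
   the margin [eps / 2] still gives [|U| < eps] off them. *)
pose A n := [set t : R | 0 < t /\ exists2 x, n%:R + Num.max rho 0 < enorm x & eps / 2 < `|U x t|].
have oA n : open (A n).
  rewrite openE => t [t0 [x xn Ut]]; near=> s; split; first by near: s; exact: lt_nbhsr.
  exists x => //; near: s.
  have cn : `|U x s| @[s --> t] --> `|U x t|.
    by apply: cvg_norm; apply: cvg_uncurry => //; exact: cvg_cst.
  exact: (cvgr_gt _ cn _ Ut).
have decA n : A n.+1 `<=` A n.
  move=> t [t0 [x xn Ut]]; split => //; exists x => //; apply: le_lt_trans xn.
  by rewrite lerD2r ler_nat.
have outA t : 0 <= t -> exists n, ~ A n t.
  move=> t0; have [M hM] := Udecay t0 (divr_gt0 eps0 (ltr0n R 2)).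
  exists (Num.bound `|M|) => -[_ [x xn Ut]].
  have := archi_boundP (normr_ge0 M) => Mb.
  have : M < enorm x.
    apply: le_lt_trans xn; apply: (le_trans (ler_norm M)); apply: (le_trans (ltW Mb)).
    by rewrite lerDl le_max lexx orbT.
  by move=> /hM; rewrite ltNge ltW.
have Cg : 0 <= C + gam by rewrite addr_ge0// ltW.
have [n [b [cb b0 b01 bT bweight]]] := decaying_weight T0 gam0 Cg oA decA outA.
pose kR := n%:R + Num.max rho 0.
pose m := dotv e1 e1 / 2.
have m0 : 0 < m by rewrite divr_gt0// dotv_gt0.
have [L [L1 hL1 hL2]] := @barrier_parameter R N rad _ _ Cg m0.
have L0 : 0 < L by lra.
have near_m : \forall e \near e1, m <= dotv e e.
  have cd : dotv e e @[e --> e1] --> dotv e1 e1.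
    by apply: (@cvg_dotv _ _ _ (nbhs e1) _ id id); exact: cvg_id.
  by apply: (cvgr_ge _ cd); rewrite /m; have := dotv_gt0 e1; rewrite e10; lra.
(* The core moves with [e], so the covering is made over the full ball: near a core point the gap
   stays positive, and near another point a violated core inequality stays violated. *)
have near_core : \forall e \near e1, [set x | enorm x <= kR] `*` `[0, T] `<=`
    [set z | core rad L kR e z.1 -> 0 < W e z.1 z.2].
  have cX : compact ([set x : 'rV[R]_N | enorm x <= kR] `*` `[0, T]).
    by apply: compact_setX; [exact: compact_enorm_le|exact: segment_compact].
  apply: ((compact_near_coveringP _).1 cX _ (nbhs e1)
    (fun e z => core rad L kR e z.1 -> 0 < W e z.1 z.2)) => -[x t] [/= xk tT].
  have t0 : 0 <= t by move: tT; rewrite in_itv/= => /andP[].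
  pose F : set_system (('rV[R]_N * R) * 'rV[R]_N) := nbhs ((x, t), e1).
  have FF : Filter F by exact: nbhs_filter.
  have cx : z.1.1 @[z --> F] --> x.
    by apply: (@cvg_comp _ _ _ fst fst _ (nbhs (x, t))); [exact: cvg_fst|exact: cvg_fst].
  have ct : z.1.2 @[z --> F] --> t.
    by apply: (@cvg_comp _ _ _ fst snd _ (nbhs (x, t))); [exact: cvg_fst|exact: cvg_snd].
  have ce : z.2 @[z --> F] --> e1 by exact: cvg_snd.
  suff : \forall z \near F, core rad L kR z.2 z.1.1 -> 0 < W z.2 z.1.1 z.1.2 by [].
  have [xc|xc] := pselect (core rad L kR e1 x).
    have cW := cvg_gap (FF := FF) e10 ce cx ct.
    have W0 : 0 < W e1 x t by apply: pos1 => //; exact: core_half_Sigma xc.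
    by apply: filterS (cvgr_gt _ cW _ W0) => z + _.
  have [xe|xe] := ltP (dotv x e1) L^-1.
    have cd := cvg_dotv (FF := FF) cx ce.
    by apply: filterS (cvgr_lt _ cd _ xe) => z zL [zc _ _]; move: zL; rewrite ltNge zc.
  have [xr|xr] := ltP ((rad != 0)%:R * dotv x x) ((rad != 0)%:R * (rad ^+ 2 + L^-1)).
    have cd := cvg_dotv (FF := FF) cx cx.
    have {}cd : (rad != 0)%:R * dotv z.1.1 z.1.1 @[z --> F] --> (rad != 0)%:R * dotv x x.
      by apply: cvgM => //; exact: cvg_cst.
    by apply: filterS (cvgr_lt _ cd _ xr) => z zL [_ zc _]; move: zL; rewrite ltNge zc.
  by exfalso; apply: xc; split.
have [x1 Dx1] := half_Sigma_neq0 e10.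
have near_x1 : \forall e \near e1, 0 < dotv x1 e /\ 0 < W e x1 0.
  apply: filterI.
    have cd : dotv x1 e @[e --> e1] --> dotv x1 e1.
      by apply: (@cvg_dotv _ _ _ (nbhs e1) _ (fun=> x1) id); [exact: cvg_cst|exact: cvg_id].
    by apply: (cvgr_gt _ cd); exact: Dx1.2.
  have cw : W e x1 0 @[e --> e1] --> W e1 x1 0.
    by apply: (@cvg_gap _ (nbhs e1) _ id (fun=> x1) (fun=> 0)) => //;
      exact: cvg_cst || exact: cvg_id.
  by apply: (cvgr_gt _ cw); exact: pos1.
near=> e.
have me : m <= dotv e e by near: e.
have e0 : e != 0 by rewrite -dotv_gt0; lra.
have ecore : [set x | enorm x <= kR] `*` `[0, T] `<=`
    [set z | core rad L kR e z.1 -> 0 < W e z.1 z.2] by near: e.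
have [x1e wx1] : 0 < dotv x1 e /\ 0 < W e x1 0 by near: e.
have one_period M : 0 <= M -> (forall x, closed_half e x -> - (M * barrier rad L e x) <= W e x 0) ->
    forall x, closed_half e x -> - (M * b T * barrier rad L e x) <= W e x 0.
  move=> M00 wM x Hx; rewrite -(gap_periodic e x (lexx 0)) add0r.
  apply: (@comparison_unbounded _ _ (W e) (half_Sigma rad e) (closed_half e)
    (barrier rad L e) b (2 * M0) C M T) => //; last exact: ltW.
  - exact: continuous_gap.
  - by move=> *; exact: gap_bound.
  - exact: open_half_Sigma.
  - exact: closed_closed_half.
  - exact: half_Sigma_closed_half.
  - exact: continuous_barrier.
  - by move=> y /(barrier_itv rad0 (ltW L0))/andP[y1 _]; lra.
  - by move=> y s Hy nDy _; exact: gap_boundary.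
  move=> y s Dy s0 sT; have [yc|yc] := pselect (core rad L kR e y).
    left; apply/ltW/(ecore (y, s)) => //; split => /=; first by case: yc.
    by rewrite in_itv/= sT ltW.
  right; have [xi [h xiM xid]] := gap_equation e0 Dy.1 s0.
  have ry := Sigma_rad_le Dy.1.
  have cC : fu s (enorm y) xi <= C by exact: fuC.
  exists (fu s (enorm y) xi); split => //.
  have [l [hl l0 lK]] := barrier_superharmonic rad0 L1 Cg m0 me hL1 hL2 Dy.
  have [lam [blam lamE]] := bweight s s0; exists lam, l; split => //.
  have /andP[B1 B3] := barrier_itv rad0 (ltW L0) (half_Sigma_closed_half Dy).
  set Bv := barrier rad L e y in B1 B3 *; set c := fu s _ _ in cC *.
  (* Within radius [kR], [lam - c >= - (C + gam)] is paid for by the Laplacian, at most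
     [- 3 (C + gam)]. Beyond it only [l <= 0] is available, and [lam >= c] is needed: at bad times
     [lam = C], at the others [c < - gam = lam]. *)
  have [ykR|ykR] := leP (enorm y) kR.
    have lK' := lK kR yc ykR.
    have lamg : - gam <= lam by case: lamE => [->|[-> _]] //; rewrite addrK; lra.
    have h1 : - (C + gam) * Bv <= (lam - c) * Bv.
      apply: ler_wpM2r; first exact: (le_trans ler01).
      by rewrite opprD addrC; apply: lerD => //; rewrite lerN2.
    have h2 := ler_wpM2l Cg B3.
    lra.
  case: lamE => [->|[-> nA]].
    have : 0 <= (C - c) * Bv by rewrite mulr_ge0 ?subr_ge0// (le_trans ler01).
    by rewrite addrK; lra.
  have Usmall z : enorm z = enorm y -> `|U z s| < eps.
    move=> zy; rewrite ltNge; apply/negP => Uz; apply: nA; split => //.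
    exists z; rewrite ?zy//; apply: lt_le_trans Uz.
    by rewrite ltr_pdivrMr// mulr_natr mulr2n ltrDl.
  have xie : `|xi| < eps by apply: xid; apply: Usmall => //; exact: enorm_refl.
  have rhoy : rho < enorm y.
    apply: le_lt_trans ykR; rewrite /kR (le_trans (_ : rho <= Num.max rho 0))// ?lerDr//.
    by rewrite le_max lexx.
  have cg : c < - gam by exact: fu_neg.
  have : 0 <= (- gam - c) * Bv by rewrite mulr_ge0 ?subr_ge0 ?(ltW cg)// (le_trans ler01).
  lra.
have M00 : 0 <= 2 * M0 by apply: le_trans (gap_bound e 0 0).
(* The iteration starts from the global bound [2 * M0], since the barrier is at least 1. *)
have iter i x : closed_half e x -> - (2 * M0 * b T ^+ i * barrier rad L e x) <= W e x 0.
  elim: i x => [|i IH] x Hx.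
    rewrite expr0 mulr1; have /andP[B1 _] := barrier_itv rad0 (ltW L0) Hx.
    have := gap_bound e x 0; rewrite ler_norml => /andP[h _].
    by have := ler_wpM2l M00 B1; lra.
  rewrite exprSr mulrA; apply: one_period => //.
  by rewrite mulr_ge0// exprn_ge0.
have w0 x : closed_half e x -> 0 <= W e x 0.
  move=> Hx.
  have cv : - (2 * M0 * b T ^+ i * barrier rad L e x) @[i --> \oo] -->
      - (2 * M0 * 0 * barrier rad L e x).
    apply: cvgN; apply: cvgM; last exact: cvg_cst.
    apply: cvgM; first exact: cvg_cst.
    by apply: cvg_expr; rewrite ger0_norm.
  rewrite mulr0 mul0r oppr0 in cv; apply: (cvgr_to_le cv).
  by near=> i; exact: iter.
apply: (gap_positive (x0 := x1)) => //; last by split => //; exact: Dx1.1.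
move=> x t Dx t0; apply: gap_ge0_initial => //; exact: half_Sigma_closed_half.
Unshelve. all: by end_near. Qed.

Let r0 := rad + 1.

(** Uniqueness is not asked for. One sphere at one time fixes the axis, and the normals found from
    it then control all radii and times. *)
Definition maximal_direction p :=
  enorm p = 1 /\ forall q, enorm q = 1 -> U (r0 *: q) 0 <= U (r0 *: p) 0.

Lemma maximal_direction_exists : exists p, maximal_direction p.
Proof.
have cS : compact [set q : 'rV[R]_N | enorm q = 1].
  rewrite (_ : [set q | _] = [set q | enorm q <= 1] `&` [set q | 1 <= enorm q]).
    apply: compact_closedI; first exact: compact_enorm_le.
    apply: (@preimage_closed _ _ (@enorm R N) [set y | 1 <= y]); last exact: closed_ge.
    by move=> x _; exact: continuous_enorm.
  apply/seteqP; split => q /= => [->//|[q1 q2]].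
  by apply/eqP; rewrite eq_le q1.
have [||p] := compact_EVT_max _ cS (f := fun q : 'rV[R]_N => U (r0 *: q) 0).
- exists (basis_vec R (Ordinal hN)) => /=.
  by rewrite /enorm dotv_basis1 sqrtr1.
- apply: continuous_subspaceT => q.
  have cq : r0 *: q' @[q' --> q] --> r0 *: q by exact: scaler_continuous.
  exact: (cvg_uncurry cU cq (cvg_cst 0)).
rewrite inE => p1 pmax; exists p; split => // q q1; apply: pmax.
by rewrite inE.
Qed.

Lemma Sigma_r0 p : enorm p = 1 -> Sigma N rad (r0 *: p).
Proof.
move=> p1; apply/SigmaP; right.
by rewrite enormZ p1 mulr1 ger0_norm /r0 ?addr_ge0// ltrDl.
Qed.

Lemma refl_r0 e p : refl e (r0 *: p) = r0 *: refl e p.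
Proof. by rewrite /refl dotvZl scalerBr scalerA; congr (_ - _ *: _); ring. Qed.

(** If [q] were on the negative side, its reflection would be on the positive side and carry a
    larger value of [U]. *)
Lemma positive_direction_maximal e q : maximal_direction q -> positive_direction e ->
  0 <= dotv e q.
Proof.
move=> [q1 qmax] [e0 pos]; rewrite leNgt; apply/negP => eq.
have r1 : 0 < r0 by rewrite /r0 ltr_wpDl.
have rq1 : enorm (refl e q) = 1 by rewrite enorm_refl.
have : 0 < W e (r0 *: refl e q) 0.
  apply: pos => //; split; first exact: Sigma_r0.
  by rewrite dotvZl dotv_refl_normal// dotvC pmulr_rgt0// oppr_gt0.
by rewrite /reflection_gap refl_r0 reflK// subr_gt0 ltNge qmax.
Qed.

(* If positivity degenerates at [e], the reflection [refl e p] of the maximal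
   direction [p] is maximal too, but lies on the wrong side of [e]. *)
Lemma positive_direction_locally_constant e p :
  maximal_direction p -> 0 < dotv e p ->
  (\forall e' \near e, positive_direction e') \/
  (\forall e' \near e, ~ positive_direction e').
Proof.
move=> maxp ep; have e0 : e != 0.
  by apply/eqP => e0; move: ep; rewrite e0 dotv0l ltxx.
have [pe|npe] := pselect (positive_direction e).
  by left; exact: positive_direction_open.
right; have [[x [t [Dx t0 Wx]]]|nneg] :=
    pselect (exists x t, [/\ half_Sigma rad e x, 0 <= t & W e x t < 0]).
  have cw : W e' x t @[e' --> e] --> W e x t.
    by apply: (@cvg_gap _ (nbhs e) _ id (fun=> x) (fun=> t)) => //; exact: cvg_cst || exact: cvg_id.
  have cd : dotv x e' @[e' --> e] --> dotv x e.
    by apply: (@cvg_dotv _ _ _ (nbhs e) _ (fun=> x) id); [exact: cvg_cst|exact: cvg_id].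
  apply: filterS2 (cvgr_lt _ cw _ Wx) (cvgr_gt _ cd _ Dx.2) => e' Wn xe' [_ pos].
  have := pos x t (conj Dx.1 xe') t0; lra.
have [p1 pmax] := maxp.
have r1 : 0 < r0 by rewrite /r0 ltr_wpDl.
(* All values of the gap are nonnegative in this case; a positive one here would make [e] a positive
   direction by the strong maximum principle. *)
have Wp : W e (r0 *: p) 0 <= 0.
  rewrite leNgt; apply/negP => Wp; apply: npe; apply: gap_positive Wp => //.
    by move=> x t Dx t0; rewrite leNgt; apply/negP => Wx; apply: nneg; exists x, t.
  by split; [exact: Sigma_r0|rewrite dotvZl dotvC pmulr_rgt0].
have maxq : maximal_direction (refl e p).
  split; first by rewrite enorm_refl.
  move=> q /pmax /le_trans; apply.
  by move: Wp; rewrite /reflection_gap refl_r0 subr_le0.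
have eq : dotv e (refl e p) < 0 by rewrite dotvC dotv_refl_normal// dotvC oppr_lt0.
have cd : dotv e' (refl e p) @[e' --> e] --> dotv e (refl e p).
  exact: continuous_dotvl.
apply: filterS (cvgr_lt _ cd _ eq) => e' e'q /(positive_direction_maximal maxq).
by rewrite leNgt e'q.
Qed.

(** Maximality only gives [e1 . p >= 0]; openness allows a small push along [p] into the open half
    space. From there the segment to [e] stays in it, and positivity is locally constant along the
    segment. *)
Lemma positive_half_space e1 p : maximal_direction p -> positive_direction e1 ->
  forall e, 0 < dotv e p -> positive_direction e.
Proof.
move=> maxp pos1 e ep; have [p1 _] := maxp.
have pp : dotv p p = 1 by rewrite -sqr_enorm p1 expr1n.
have [e2 pos2 e2p] : exists2 e2, positive_direction e2 & 0 < dotv e2 p.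
  have := positive_direction_maximal maxp pos1 => e1p.
  have near_pos' : \forall h \near 0^'+, positive_direction (e1 + h *: p).
    have cl : e1 + h *: p @[h --> (0 : R)^'+] --> e1 by apply: cvg_at_right_filter; exact: cvg_line.
    exact: cl (positive_direction_open pos1).
  have [h [h0 posh]] : exists h : R, 0 < h /\ positive_direction (e1 + h *: p).
    by near (0 : R)^'+ => h; exists h; split; near: h; [exact: nbhs_right_gt|].
  by exists (e1 + h *: p) => //; rewrite dotvDl dotvZl pp mulr1; lra.
suff : (fun s => positive_direction (e2 + s *: (e - e2))) 1.
  by rewrite /= scale1r addrC subrK.
apply: (unit_interval_induction (Q := fun s => positive_direction (e2 + s *: (e - e2)))).
  by rewrite scale0r addr0.
move=> s /andP[s0 s1].
have esp : 0 < dotv (e2 + s *: (e - e2)) p.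
  rewrite dotvDl dotvZl dotvBl; nra.
have cs : e2 + a *: (e - e2) @[a --> s] --> e2 + s *: (e - e2).
  by apply: cvgD; [exact: cvg_cst|apply: cvgZr_tmp; exact: cvg_id].
have inb d a : `|a - s| < d -> ball s d a by rewrite -ball_normE/= distrC.
have [/cs/nbhs_ballP[d /= d0 near]|/cs/nbhs_ballP[d /= d0 near]] :=
  positive_direction_locally_constant maxp esp; exists d => // a b ad bd _ _.
  by move=> _; exact/near/inb.
by move=> posa; have := near a (inb _ _ ad).
Unshelve. all: by end_near. Qed.

(** Limit of the strict inequality along the normals [e + h p], [h > 0]. *)
Lemma gap_ge0_half_space e1 p e x t : maximal_direction p -> positive_direction e1 ->
  e != 0 -> 0 <= dotv e p -> half_Sigma rad e x -> 0 <= t -> 0 <= W e x t.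
Proof.
move=> maxp pos1 e0 ep [Sx xe] t0; have [p1 _] := maxp.
have pp : dotv p p = 1 by rewrite -sqr_enorm p1 expr1n.
have cl : e + h *: p @[h --> (0 : R)^'+] --> e.
  by apply: cvg_at_right_filter; exact: cvg_line.
have cw : W (e + h *: p) x t @[h --> (0 : R)^'+] --> W e x t.
  by apply: cvg_gap => //; exact: cvg_cst.
apply: (cvgr_to_ge cw); near=> h.
have h0 : 0 < h by near: h; exact: nbhs_right_gt.
have [_ pos] : positive_direction (e + h *: p).
  by apply: positive_half_space maxp pos1 _ _; rewrite dotvDl dotvZl pp; lra.
apply/ltW/pos => //; split => //; near: h.
have cd : dotv x (e + h *: p) @[h --> (0 : R)^'+] --> dotv x e.
  by apply: cvg_dotv => //; exact: cvg_cst.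
exact: (cvgr_gt _ cd).
Unshelve. all: by end_near. Qed.

(** Both [e] and [- e] lie in the closed half space and define the same reflection, so the gap has
    both signs. *)
Lemma gap_eq0_orthogonal e1 p e x t : maximal_direction p -> positive_direction e1 ->
  e != 0 -> dotv e p = 0 -> 0 <= t -> W e x t = 0.
Proof.
move=> maxp pos1 e0 ep t0.
have [Sx|/gap_out ->//] := pselect (Sigma N rad x).
have ge0 := gap_ge0_half_space maxp pos1.
have gt y : Sigma N rad y -> 0 < dotv y e -> W e y t = 0.
  move=> Sy ye; apply/eqP; rewrite eq_le ge0// ?ep// andbT -oppr_ge0 -gap_refl//.
  have -> : W e (refl e y) t = W (- e) (refl e y) t by rewrite /reflection_gap reflN.
  apply: ge0; rewrite ?oppr_eq0// ?dotvNl ?ep ?oppr0//.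
  by split; [exact/Sigma_refl|rewrite dotvNr dotv_refl_normal// opprK].
have [xe|xe|xe] := ltgtP (dotv x e) 0; [|exact: gt|].
- rewrite -[LHS]opprK -gap_refl// gt ?oppr0//; first exact/Sigma_refl.
  by rewrite dotv_refl_normal// oppr_gt0.
- by rewrite /reflection_gap refl_fix// subrr.
Qed.

Lemma rotating_planes e1 x0 : e1 != 0 ->
  (forall x, closed_half e1 x -> 0 <= W e1 x 0) ->
  half_Sigma rad e1 x0 -> 0 < W e1 x0 0 ->
  exists p, [/\ enorm p = 1,
    forall e, 0 < dotv e p -> positive_direction e,
    forall e x t, e != 0 -> 0 <= dotv e p -> half_Sigma rad e x -> 0 <= t -> 0 <= W e x t &
    forall e x t, e != 0 -> dotv e p = 0 -> 0 <= t -> W e x t = 0].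
Proof.
move=> e10 w0 Dx0 wx0; have [p maxp] := maximal_direction_exists.
have pos1 : positive_direction e1.
  apply: gap_positive wx0 => // x t Dx t0.
  by apply: gap_ge0_initial => //; exact: half_Sigma_closed_half.
exists p; split; first exact: maxp.1.
- exact: positive_half_space maxp pos1.
- by move=> e x t; exact: gap_ge0_half_space maxp pos1.
- by move=> e x t; exact: gap_eq0_orthogonal maxp pos1.
Qed.

End RotatingPlanes.

(** * The nonlinearity and the zero extension of the solution *)

Section PolarAngle.
Context {R : realType} {N : nat}.
Implicit Types (x y p : 'rV[R]_N).

(** Turns a comparison of angles into the sign of [(x - y) . p], the condition on the normal
    [x - y]. *)
Lemma polar_angle_lt p x y : enorm p = 1 -> x != 0 -> enorm x = enorm y ->
  (polar_angle p x < polar_angle p y) = (dotv y p < dotv x p).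
Proof.
move=> p1 x0 xy; have nx : 0 < enorm x by rewrite enorm_gt0.
have unit z : enorm z = enorm x -> dotv ((enorm z)^-1 *: z) p \in `[-1, 1]%R.
  move=> zx; rewrite in_itv/=; apply: dotv_unit_le1; last by rewrite -sqr_enorm p1 expr1n.
  by rewrite -sqr_enorm enormZ zx ger0_norm ?invr_ge0 ?ltW// mulVf ?gt_eqF// expr1n.
have ux := unit x erefl; have uy := unit y (esym xy).
have acosI (a : R) : a \in `[-1, 1]%R -> acos a \in `[0, pi]%R.
  by rewrite !in_itv/= => a1; rewrite acos_ge0// acos_lepi.
rewrite /polar_angle -(ltr_cos (acosI _ ux) (acosI _ uy)) !acosK//.
by rewrite -xy !dotvZl ltr_pM2l// invr_gt0.
Qed.

End PolarAngle.

Lemma ler_dist_chain (R : realType) (a b c d C : R) :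
  `|a - b| <= 1 -> `|c - b| <= 1 -> `|c - d| <= C -> `|a - d| <= C + 2.
Proof.
rewrite !ler_norml => /andP[? ?] /andP[? ?] /andP[? ?].
by apply/andP; split; lra.
Qed.

(** * Bounds on [f_u] uniform in time *)

Section Nonlinearity.
Context {R : realType}.
Variables (rad : R) (f : R -> R -> R -> R).
Implicit Types (t r s a b : R).

Lemma partial_u_mvt t r a b : (forall v, derivable (f t r) v 1) -> exists xi,
  [/\ Num.min a b <= xi, xi <= Num.max a b &
    f t r a - f t r b = partial_u f t r xi * (a - b)].
Proof.
move=> df.
have dE (v : R) : is_derive v 1 (f t r) (partial_u f t r v).
  by apply: DeriveDef => //; rewrite /partial_u derive1E.
have cf : forall A : set R, {within A, continuous (f t r)}.
  by move=> A; apply: continuous_subspaceT => v; exact/differentiable_continuous/derivable1_diffP.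
have [ab|ba] := leP a b.
  have [xi] := MVT_segment ab (fun v _ => dE v) (cf _).
  rewrite in_itv/= => /andP[axi xib] E; exists xi; split => //.
  by rewrite -opprB E -mulrN opprB.
have [xi] := MVT_segment (ltW ba) (fun v _ => dE v) (cf _).
by rewrite in_itv/= => /andP[axi xib] E; exists xi; split.
Qed.

Hypothesis hf_unif : forall v : R,
  ereal_sup [set (`|partial_u f t r w - partial_u f t r v|)%:E
              | t in `]0, +oo[ & r in `[rad, +oo[] @[w --> v^'] --> 0%E.
Hypothesis hf_ubnd : forall (K : R) (J : set R), 0 < K ->
  J `<=` `[rad, +oo[ -> compact (closure J) -> closure J `<=` `[rad, +oo[ ->
  (ereal_sup [set y | exists t r s : R,
     [/\ 0 < t, J r, - K <= s <= K & y = (`|partial_u f t r s|)%:E]]%R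
     < +oo)%E.

Lemma partial_u_bounded K r1 : 0 < K -> exists2 C1, 0 <= C1 &
  forall t r s, 0 < t -> rad <= r -> r <= r1 -> `|s| <= K -> `|partial_u f t r s| <= C1.
Proof.
move=> K0; have clJ : closure `[rad, r1] = (`[rad, r1] : set R).
  by apply/esym/closure_id; exact: itv_closed.
have sJ : `[rad, r1] `<=` (`[rad, +oo[ : set R).
  by move=> r /=; rewrite !in_itv/= andbT => /andP[].
have := @hf_ubnd K `[rad, r1] K0 sJ; rewrite clJ => /(_ (@segment_compact _ _ _) sJ).
set S := [set y | _] => Soo.
exists `|fine (ereal_sup S)| => // t r s t0 rr rr1 sK.
have Sx : S (`|partial_u f t r s|)%:E.
  by exists t, r, s; split => //; rewrite -?ler_norml//= in_itv/= rr.
have le := ereal_sup_ubound Sx.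
rewrite -lee_fin (le_trans le)//.
have fin : ereal_sup S \is a fin_num.
  by rewrite ge0_fin_numE// (le_trans _ le)// lee_fin.
by rewrite -[leLHS](fineK fin) lee_fin ler_norm.
Qed.

Lemma partial_u_oscillation v : exists2 d, 0 < d & forall w t r,
  `|w - v| < d -> 0 < t -> rad <= r -> `|partial_u f t r w - partial_u f t r v| <= 1.
Proof.
have : nbhs (0%E : \bar R) [set x | (x < 1%:E)%E] by apply: open_ereal_lt'; rewrite lte_fin.
move=> /(hf_unif v) nb.
have : \forall w \near v^', (ereal_sup [set (`|partial_u f t r w - partial_u f t r v|)%:E
    | t in `]0%R, +oo[ & r in `[rad, +oo[] < 1%:E)%E := nb.
rewrite near_withinE => /nbhs_ballP[d /= d0 near].
exists d => // w t r wv t0 rr; have [->|wnv] := eqVneq w v; first by rewrite subrr normr0.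
have := near w; rewrite -ball_normE/= distrC => /(_ wv wnv) /ltW.
rewrite -lee_fin; apply: le_trans; apply: ereal_sup_ubound.
by exists t; [rewrite /= in_itv/= t0|exists r => //; rewrite /= in_itv/= rr].
Qed.

(** Continuity in [u] is uniform in [t] and [r], so [f_u] oscillates by at most 1 about each point
    of the segment from 0 to [a]; chaining finitely many such steps costs 2 each and stays uniform
    in [t] and [r]. *)
Lemma partial_u_variation a : exists C2, forall s t r, 0 <= s <= 1 -> 0 < t -> rad <= r ->
  `|partial_u f t r (s * a) - partial_u f t r 0| <= C2.
Proof.
pose Q b := exists C2, forall s t r, 0 <= s <= b -> 0 < t -> rad <= r ->
  `|partial_u f t r (s * a) - partial_u f t r 0| <= C2.
suff : Q 1 by [].
apply: unit_interval_induction.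
  exists 0 => s t r s0 _ _; rewrite (_ : s = 0) ?mul0r ?subrr ?normr0//.
  by apply/eqP; rewrite eq_le andbC.
move=> s s01; have [d d0 osc] := partial_u_oscillation (s * a).
have k0 : 0 < `|a| + 1 by rewrite ltr_wpDl.
exists (d / (`|a| + 1)); first by rewrite divr_gt0.
have near c : `|c - s| < d / (`|a| + 1) -> `|c * a - s * a| < d.
  rewrite ltr_pdivlMr// -mulrBl normrM; apply: le_lt_trans.
  by apply: ler_wpM2l => //; rewrite lerDl.
move=> b c bs cs b01 c01 [C2 hC2]; exists (C2 + 2) => q t r /andP[q0 qc] t0 rr.
have [qb|bq] := leP q b.
  by have := hC2 q t r; rewrite q0 qb => /(_ isT t0 rr); lra.
have qs : `|q - s| < d / (`|a| + 1).
  by move: bs cs; rewrite !ltr_norml => /andP[? ?] /andP[? ?]; apply/andP; split; lra.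
have h1 := osc _ t r (near q qs) t0 rr.
have h2 := osc _ t r (near b bs) t0 rr.
have h3 : `|partial_u f t r (b * a) - partial_u f t r 0| <= C2.
  by apply: hC2 => //; rewrite lexx andbT; case/andP: b01.
exact: ler_dist_chain h1 h2 h3.
Qed.

(** Radii up to [rho] are covered by the local bound; beyond, [f_u] at 0 is nonpositive and its
    variation is bounded. Nothing bounds [f_u] at 0 from below at infinity, hence a one-sided
    conclusion. *)
Lemma partial_u_upper_bound K rho : 0 < K ->
  (forall t r, 0 < t -> rad <= r -> rho < r -> partial_u f t r 0 <= 0) ->
  exists2 C, 0 <= C & forall t r s, 0 < t -> rad <= r -> `|s| <= K -> partial_u f t r s <= C.
Proof.
move=> K0 neg; have [C1 C10 hC1] := partial_u_bounded rho K0.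
have [C2 hC2] := partial_u_variation K; have [C3 hC3] := partial_u_variation (- K).
exists (C1 + `|C2| + `|C3|); first by rewrite !addr_ge0.
move=> t r s t0 rr sK; have n2 := ler_norm C2; have n3 := ler_norm C3.
have p2 := normr_ge0 C2; have p3 := normr_ge0 C3.
have [rrho|rhor] := leP r rho.
  by have := hC1 t r s t0 rr rrho sK; rewrite ler_norml => /andP[_]; lra.
have n0 := neg t r t0 rr rhor.
have sK1 : 0 <= `|s| / K <= 1 by rewrite divr_ge0 ?(ltW K0)//= ler_pdivrMr// mul1r.
have [s0|s0] := leP 0 s.
  have E : `|s| / K * K = s by rewrite divfK ?gt_eqF// ger0_norm.
  by have := hC2 _ t r sK1 t0 rr; rewrite E ler_norml => /andP[_]; lra.
have E : `|s| / K * - K = s by rewrite mulrN divfK ?gt_eqF// ltr0_norm// opprK.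
by have := hC3 _ t r sK1 t0 rr; rewrite E ler_norml => /andP[_]; lra.
Qed.

End Nonlinearity.

(** * Continuous extension of the solution to all of space and time *)

Section Extension.
Context {R : realType} {N : nat}.
Implicit Types (x y e : 'rV[R]_N) (t s : R).
Variables (rad : R) (u : 'rV[R]_N -> R -> R).
Hypotheses (rad0 : 0 <= rad)
  (hu_cont : {within closure (Sigma N rad) `*` `[0, +oo[,
     continuous (fun z : 'rV[R]_N * R => u z.1 z.2)})
  (hu_bd : forall (x : 'rV[R]_N) (t : R), boundary (Sigma N rad) x -> 0 < t -> u x t = 0).

(** Time is frozen at 0 for negative [t], so that the extension is continuous on the whole product
    and relative topologies disappear from the comparison arguments. *)
Definition zero_extension x t : R := if rad <= enorm x then u x (Num.max t 0) else 0.

Lemma closure_Sigma x : rad <= enorm x -> closure (Sigma N rad) x.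
Proof.
move=> rx; have [Sx|nSx] := pselect (Sigma N rad x); first exact: subset_closure.
have rp : 0 < rad.
  by rewrite lt_neqAle rad0 andbT; apply/eqP => r0; apply: nSx; apply/SigmaP; left.
have cl : x + h *: x @[h --> (0 : R)^'+] --> x by apply: cvg_at_right_filter; exact: cvg_line.
apply: (@closed_cvg _ _ ((0 : R)^'+) _ (fun h => x + h *: x) (closure (Sigma N rad))
  (@closed_closure _ _) _ x cl).
near=> h; apply: subset_closure; apply/SigmaP; right.
have h0 : 0 < h by near: h; exact: nbhs_right_gt.
have -> : x + h *: x = (1 + h) *: x by rewrite scalerDl scale1r.
rewrite enormZ gtr0_norm; last by lra.
have : 0 < h * enorm x by rewrite mulr_gt0//; lra.
lra.
Unshelve. all: by end_near. Qed.

Lemma u_cvg (T : Type) (F : set_system T) {FF : Filter F} (g : T -> 'rV[R]_N)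
    (h : T -> R) x t : rad <= enorm x -> 0 <= t -> g @ F --> x -> h @ F --> t ->
  (\forall i \near F, rad <= enorm (g i) /\ 0 <= h i) ->
  (fun i => u (g i) (h i)) @ F --> u x t.
Proof.
move=> rx t0 gx ht nA P nP.
have /subspace_continuousP/(_ (x, t)) := hu_cont.
have A0 : (closure (Sigma N rad) `*` `[0, +oo[) (x, t).
  by split; [exact: closure_Sigma|rewrite /= in_itv/= t0].
move=> /(_ A0 _ nP) nP1.
have nP2 : \forall z \near (x, t), (closure (Sigma N rad) `*` `[0, +oo[) z ->
  P (u z.1 z.2) := nP1.
have nP3 : \forall i \near F, (closure (Sigma N rad) `*` `[0, +oo[) (g i, h i) ->
  P (u (g i) (h i)) by exact: (cvg_pair gx ht nP2).
rewrite nbhs_filterE; apply: filterS2 nA nP3 => i [gi hi]; apply.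
by split; [exact: closure_Sigma|rewrite /= in_itv/= hi].
Qed.

(** The boundary condition is given for positive times; time 0 follows by continuity from the
    right. *)
Lemma u_boundary x t : rad <= enorm x -> ~ Sigma N rad x -> 0 <= t -> u x t = 0.
Proof.
move=> rx nSx; have bx : boundary (Sigma N rad) x.
  split; first exact: closure_Sigma.
  by move=> /interior_subset.
rewrite le_eqVlt => /orP[/eqP<-|]; last exact: hu_bd.
have c0 : u x h @[h --> (0 : R)^'+] --> u x 0.
  apply: u_cvg => //; [exact: cvg_cst|by apply: cvg_at_right_filter; exact: cvg_id|].
  by near=> h; split => //; near: h; exact: nbhs_right_ge.
have c1 : u x h @[h --> (0 : R)^'+] --> (0 : R).
  apply: cvg_near_cst; near=> h; apply/hu_bd => //; near: h; exact: nbhs_right_gt.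
exact: (cvg_unique _ c0 c1).
Unshelve. all: by end_near. Qed.

Lemma zero_extension_in x t : Sigma N rad x -> 0 <= t -> zero_extension x t = u x t.
Proof.
by move=> Sx t0; rewrite /zero_extension Sigma_rad_le// max_l.
Qed.

Lemma zero_extension_out x t : ~ Sigma N rad x -> zero_extension x t = 0.
Proof.
move=> nSx; rewrite /zero_extension; case: ifP => // rx; apply: u_boundary => //.
by rewrite le_max lexx orbT.
Qed.

Lemma continuous_zero_extension : continuous (fun z => zero_extension z.1 z.2).
Proof.
move=> [x t] /=; have [rx|xr] := leP rad (enorm x); last first.
  have nout : \forall z \near (x, t), enorm z.1 < rad.
    have ce : enorm z.1 @[z --> nbhs (x, t)] --> enorm x.
      apply: (@cvg_comp _ _ _ fst (@enorm R N) _ (nbhs x)); first exact: cvg_fst.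
      exact: continuous_enorm.
    exact: (cvgr_lt (enorm x) ce).
  rewrite /continuous_at /= {2}/zero_extension leNgt xr /=.
  apply: cvg_near_cst; apply: filterS nout => z zr.
  by rewrite /zero_extension leNgt zr.
pose A : set ('rV[R]_N * R) := [set z | rad <= enorm z.1].
have cmax : Num.max z.2 0 @[z --> nbhs (x, t)] --> Num.max t 0.
  apply: (@cvg_comp _ _ _ snd (fun s : R => Num.max s 0) _ (nbhs t)); first exact: cvg_snd.
  by apply: (@continuous_max _ _ id (fun=> 0 : R)); [exact: cvg_id|exact: cvg_cst].
have cu : u z.1 (Num.max z.2 0) @[z --> within A (nbhs (x, t))] --> u x (Num.max t 0).
  apply: u_cvg => //.
  - by rewrite le_max lexx orbT.
  - by apply: cvg_within_filter; exact: cvg_fst.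
  - exact: cvg_within_filter.
  - by rewrite near_withinE; near=> z; move=> Az; split => //; rewrite le_max lexx orbT.
have [Sx|nSx] := pselect (Sigma N rad x).
  rewrite /continuous_at /= {2}/zero_extension rx.
  have nS : \forall z \near (x, t), Sigma N rad z.1.
    apply: (@cvg_fst _ _ (nbhs x) (nbhs t)).
    by apply: open_nbhs_nbhs; split => //; exact: open_Sigma.
  have nA : nbhs (x, t) A.
    apply: filterS nS => z; exact: Sigma_rad_le.
  rewrite within_interior // in cu.
  apply: cvg_trans cu; apply: near_eq_cvg; apply: filterS nA => z Az.
  by rewrite /zero_extension Az.
(* On the boundary sphere the limit is 0: from the closed domain by continuity of [u], and inside
   the ball trivially. *)
rewrite /continuous_at /= (zero_extension_out _ nSx); have u0 : u x (Num.max t 0) = 0.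
  by rewrite u_boundary// le_max lexx orbT.
rewrite u0 in cu; apply/cvgrPdist_le => eps eps0.
have /cvgrPdist_le/(_ _ eps0) := cu; rewrite near_withinE; apply: filterS => z zA.
by rewrite /zero_extension; case: ifP => // _; rewrite subrr normr0 ltW.
Unshelve. all: by end_near. Qed.

End Extension.

(** * The equation satisfied by the reflection gap *)

Section HeatEquation.
Context {R : realType} {N : nat}.
Implicit Types (x y e : 'rV[R]_N) (t s : R).

Lemma has_laplacian_near_eq (g h : 'rV[R]_N -> R) x l :
  (\forall y \near x, g y = h y) -> has_laplacian g x l -> has_laplacian h x l.
Proof.
move=> gh [a [da ->]]; exists a; split => // i; apply: is_derive2_near_eq (da i).
exact: (@cvg_line _ _ x (basis_vec R i)) gh.
Qed.

Lemma within_slice (A : set 'rV[R]_N) (J : set R) (G : 'rV[R]_N -> R -> R) y t :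
  {within A `*` J, continuous (fun z => G z.1 z.2)} -> open A -> A y -> J t ->
  {for y, continuous (G ^~ t)}.
Proof.
move=> /subspace_continuousP/(_ (y, t)) c oA Ay Jt P nP.
have nP2 : \forall z \near (y, t), (A `*` J) z -> P (G z.1 z.2) := c (conj Ay Jt) P nP.
have nP3 : \forall z \near y, (A `*` J) (z, t) -> P (G z t).
  exact: (@cvg_pair _ _ _ (nbhs y) (nbhs y) (nbhs t) _ _ _ id (fun=> t)
    (@cvg_id _ _) (cvg_cst t) _ nP2).
rewrite nbhs_filterE; apply: filterS2 (open_nbhs_nbhs (conj oA Ay)) nP3 => z Az; apply.
by split.
Qed.

Lemma heat_at_gap (rad : R) (u : 'rV[R]_N -> R -> R) (rhs : 'rV[R]_N -> R -> R) e x t :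
  C21 (Sigma N rad) `]0, +oo[ u ->
  (forall y s, Sigma N rad y -> 0 < s -> derive1 (u y) s - laplacian (u ^~ s) y = rhs y s) ->
  e != 0 -> Sigma N rad x -> 0 < t ->
  heat_at (reflection_gap (zero_extension rad u) e) x t (rhs x t - rhs (refl e x) t).
Proof.
move=> [_ [du _] [dx cx] [dxx cxx]] eqn e0 Sx t0.
have J s : 0 < s -> `]0, +oo[%classic s by move=> s0; rewrite /= in_itv/= s0.
have oS := @open_Sigma R N rad.
have Srx : Sigma N rad (refl e x) by apply/SigmaP; rewrite enorm_refl//; exact/SigmaP.
have UE y s : Sigma N rad y -> 0 < s -> zero_extension rad u y s = u y s.
  by move=> Sy s0; apply: zero_extension_in => //; exact: ltW.
exists (derive1 (u x) t - derive1 (u (refl e x)) t),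
  (laplacian (u ^~ t) x + -1 * laplacian (u ^~ t) (refl e x)); split.
- have dE y : Sigma N rad y -> is_derive t 1 (u y) (derive1 (u y) t).
    by move=> Sy; apply: DeriveDef; [exact: du (J _ t0)|rewrite derive1E].
  apply: near_eq_is_derive (is_deriveB (dE _ Sx) (dE _ Srx)).
  near=> s; have s0 : 0 < s by near: s; exact: lt_nbhsr.
  by rewrite /reflection_gap !UE.
- have d1 i y : Sigma N rad y -> derivable (u ^~ t) y (basis_vec R i).
    by move=> Sy; exact: dx (J _ t0).
  have c1 i y : Sigma N rad y -> {for y, continuous (partial_x i (u ^~ t))}.
    move=> Sy.
    exact: (within_slice (G := fun y t => partial_x i (u ^~ t) y) (cx i) oS Sy (J _ t0)).
  have d2 i j y : Sigma N rad y -> derivable (partial_x i (u ^~ t)) y (basis_vec R j).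
    by move=> Sy; exact: dxx (J _ t0).
  have c2 i j y : Sigma N rad y -> {for y, continuous (partial_x j (partial_x i (u ^~ t)))}.
    move=> Sy.
    exact: (within_slice (G := fun y t => partial_x j (partial_x i (u ^~ t)) y)
      (cxx i j) oS Sy (J _ t0)).
  have L1 := has_laplacian_C2 oS Sx d1 c1 d2 c2.
  have L2 := has_laplacian_refl e0 oS Srx d1 c1 d2 c2.
  apply: has_laplacian_near_eq (has_laplacianD L1 (has_laplacianZ (-1) L2)).
  have nS := open_nbhs_nbhs (conj oS Sx); apply: filterS nS => y Sy.
  rewrite /reflection_gap !UE//= ?mulN1r//.
  by apply/SigmaP; rewrite enorm_refl//; exact/SigmaP.
- by rewrite -(eqn _ _ Sx t0) -(eqn _ _ Srx t0) mulN1r !opprD !opprK addrACA.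
Unshelve. all: by end_near. Qed.

End HeatEquation.

(** * Checking the assumptions of the rotating plane argument and reading off the symmetry *)

Theorem corollary1p6 (R : realType) (N : nat) (hN : (2 <= N)%N)
  (rad : R) (hrad : 0 <= rad)
  (f : R -> R -> R -> R)
  (hf_bnd : forall r : R, 0 < r -> exists K : R, 0 < K /\
     (ereal_sup [set (`|f t s 0|)%:E | t in `]0, +oo[ & s in `[rad, r]]%R
        < K%:E)%E)
  (hf_cont : forall v : R,
     {within `[0, +oo[ `*` `[rad, +oo[,
        continuous (fun tr : R * R => f tr.1 tr.2 v)})
  (hf_C1 : forall t r : R, 0 <= t -> rad <= r ->
     (forall v : R, derivable (f t r) v 1) /\ continuous (partial_u f t r))
  (hf_unif : forall v : R,
     ereal_sup [set (`|partial_u f t r w - partial_u f t r v|)%:E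
                 | t in `]0, +oo[ & r in `[rad, +oo[] @[w --> v^'] --> 0%E)
  (hf_ubnd : forall (K : R) (J : set R), 0 < K ->
     J `<=` `[rad, +oo[ -> compact (closure J) -> closure J `<=` `[rad, +oo[ ->
     (ereal_sup [set y | exists t r s : R,
        [/\ 0 < t, J r, - K <= s <= K & y = (`|partial_u f t r s|)%:E]]%R
        < +oo)%E)
  (hf_neg : exists rho gamma eps : R, [/\ 0 < rho, 0 < gamma, 0 < eps &
     forall (x : 'rV[R]_N) (t s : R), Sigma N rad x -> rho < enorm x ->
       0 <= t -> - eps < s < eps -> partial_u f t (enorm x) s < - gamma])
  (u : 'rV[R]_N -> R -> R) (u0 : 'rV[R]_N -> R)
  (hu_C21 : C21 (Sigma N rad) `]0, +oo[ u)
  (hu_cont : {within closure (Sigma N rad) `*` `[0, +oo[,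
     continuous (fun z : 'rV[R]_N * R => u z.1 z.2)})
  (hu_bnd : exists M : R, forall (x : 'rV[R]_N) (t : R), Sigma N rad x -> 0 <= t -> `|u x t| <= M)
  (hu_per : exists T : R, 0 < T /\
     forall (x : 'rV[R]_N) (t : R), Sigma N rad x -> 0 <= t -> u x (t + T) = u x t)
  (hu_eq : forall (x : 'rV[R]_N) (t : R), Sigma N rad x -> 0 < t ->
     derive1 (u x) t - laplacian (u ^~ t) x = f t (enorm x) (u x t))
  (hu_bd : forall (x : 'rV[R]_N) (t : R), boundary (Sigma N rad) x -> 0 < t -> u x t = 0)
  (hu_init : forall x : 'rV[R]_N, Sigma N rad x -> u x 0 = u0 x)
  (hu0_C0 : C0_closure (Sigma N rad) u0)
  (hu0_refl : exists e : 'rV[R]_N, [/\ esphere R N e,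
     forall x : 'rV[R]_N, half (Sigma N rad) e x -> u0 (reflection e x) <= u0 x
     & exists2 x : 'rV[R]_N, Sigma N rad x & u0 x <> u0 (reflection e x)])
  (hu_inf : forall t : R, 0 <= t -> vanishes_at_infinity (Sigma N rad) (u ^~ t)) :
  exists p : 'rV[R]_N, esphere R N p /\
    forall t : R, 0 <= t ->
      foliated_Schwarz_symmetric (Sigma N rad) p (u ^~ t) /\
      strictly_decreasing_in_angle (Sigma N rad) p (u ^~ t).
Proof.
have [rho [gam [eps [rho0 gam0 eps0 neg]]]] := hf_neg.
have [M hM] := hu_bnd; have [T [T0 hT]] := hu_per.
have N0 : (0 < N)%N by apply: leq_trans hN.
pose M0 := `|M| + 1; have M00 : 0 < M0 by rewrite ltr_wpDl.
(* [hf_neg] is stated for points of [Sigma]; every radius above [rho1] is the norm of such a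
   point. *)
pose U := zero_extension rad u; pose rho1 := Num.max rho rad.
have UE x t : Sigma N rad x -> 0 <= t -> U x t = u x t by exact: zero_extension_in.
have Uout x t : ~ Sigma N rad x -> U x t = 0 by exact: (zero_extension_out hrad hu_cont hu_bd).
have UE' x t : Sigma N rad x -> U x t = u x (Num.max t 0).
  by move=> Sx; rewrite /U /zero_extension Sigma_rad_le.
have UB x t : `|U x t| <= M0.
  have [Sx|/Uout->] := pselect (Sigma N rad x); last by rewrite normr0 ltW.
  rewrite UE' // (le_trans (hM _ _ Sx _)) ?le_max ?lexx ?orbT//.
  by rewrite /M0 (le_trans (ler_norm M))// lerDl.
have UT x t : 0 <= t -> U x (t + T) = U x t.
  move=> t0; have [Sx|nS] := pselect (Sigma N rad x); last by rewrite !Uout.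
  by rewrite !UE ?hT// addr_ge0// ltW.
have Udecay t d : 0 <= t -> 0 < d -> exists K : R, forall x, K < enorm x -> `|U x t| < d.
  move=> t0 d0; have [K hK] := hu_inf t t0 d d0; exists K => x xK.
  have [Sx|/Uout->] := pselect (Sigma N rad x); last by rewrite normr0.
  by rewrite UE//; exact: hK.
have fneg t r s : 0 < t -> rad <= r -> rho1 < r -> `|s| < eps -> partial_u f t r s < - gam.
  move=> t0 rr; rewrite gt_max => /andP[rhor radr] seps.
  pose x := r *: basis_vec R (Ordinal N0).
  have xr : enorm x = r.
    rewrite /x enormZ /enorm dotv_basis1 sqrtr1 mulr1 ger0_norm//.
    exact: le_trans rr.
  have := neg x t s; rewrite xr; apply => //; [|exact: ltW|by rewrite -ltr_norml].
  by apply/SigmaP; right; rewrite xr.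
have fneg0 t r : 0 < t -> rad <= r -> rho1 < r -> partial_u f t r 0 <= 0.
  move=> t0 rr rhor; have := fneg t r 0 t0 rr rhor; rewrite normr0 => /(_ eps0); lra.
have [C C0 hC] := partial_u_upper_bound hf_unif hf_ubnd M00 fneg0.
have fmvt t r a b : 0 < t -> rad <= r -> exists xi,
    [/\ Num.min a b <= xi, xi <= Num.max a b & f t r a - f t r b = partial_u f t r xi * (a - b)].
  by move=> t0 rr; have [df _] := hf_C1 t r (ltW t0) rr; exact: partial_u_mvt df.
have cU : continuous (fun z => U z.1 z.2) by exact: continuous_zero_extension.
have heatU e x t : e != 0 -> Sigma N rad x -> 0 < t -> heat_at (reflection_gap U e) x t
    (f t (enorm x) (U x t) - f t (enorm x) (U (refl e x) t)).
  move=> e0 Sx t0.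
  have := heat_at_gap (rhs := fun y s => f s (enorm y) (u y s)) hu_C21 hu_eq e0 Sx t0.
  rewrite enorm_refl// -!UE ?(ltW t0)//.
  by apply/SigmaP; rewrite enorm_refl//; exact/SigmaP.
have [e1 [e1S u0ge [x0 Sx0 u0ne]]] := hu0_refl.
have e10 : e1 != 0.
  by rewrite -enorm_gt0; move: e1S; rewrite /esphere /= => ->.
have Srefl x : Sigma N rad x -> Sigma N rad (refl e1 x).
  by move=> Sx; apply/SigmaP; rewrite enorm_refl//; exact/SigmaP.
have W0E x : Sigma N rad x -> reflection_gap U e1 x 0 = u0 x - u0 (reflection e1 x).
  move=> Sx; rewrite /reflection_gap reflection_refl// !UE// ?hu_init//; exact: Srefl.
have w0 x : closed_half rad e1 x -> 0 <= reflection_gap U e1 x 0.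
  move=> Hx; have [Dx|nDx] := pselect (half_Sigma rad e1 x); last exact: gap_boundary nDx.
  by rewrite W0E ?subr_ge0; [exact: u0ge|exact: Dx.1].
(* The point where [u0] differs from its reflection may lie on either side. The gap is odd under
   reflection, so on the wrong side the reflected point serves, and on the hyperplane there is no
   difference. *)
have [x1 Dx1 wx1] : exists2 x1, half_Sigma rad e1 x1 & 0 < reflection_gap U e1 x1 0.
  have wne : reflection_gap U e1 x0 0 != 0 by rewrite W0E// subr_eq0; exact/eqP.
  have [xe|xe|xe] := ltgtP (dotv x0 e1) 0.
  - have Dr : half_Sigma rad e1 (refl e1 x0).
      by split; [exact: Srefl|rewrite dotv_refl_normal// oppr_gt0].
    exists (refl e1 x0) => //; rewrite lt_neqAle w0 ?andbT; last exact: half_Sigma_closed_half.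
    by rewrite gap_refl// eq_sym oppr_eq0.
  - have D0 : half_Sigma rad e1 x0 by split.
    by exists x0 => //; rewrite lt_neqAle eq_sym wne w0//; exact: half_Sigma_closed_half.
  - by move: wne; rewrite /reflection_gap refl_fix// subrr eqxx.
have [p [p1 pos ge0 eq0]] := @rotating_planes R N rad U f (partial_u f) M0 T C rho1 gam eps
  N0 hrad T0 C0 gam0 eps0 cU UB UT Uout Udecay fmvt hC (fun r1 => partial_u_bounded hf_ubnd r1 M00)
  fneg heatU e1 x1 e10 w0 Dx1 wx1.
exists p; split => // t t0.
have gapE x y : Sigma N rad x -> Sigma N rad y -> enorm x = enorm y -> x != y ->
    reflection_gap U (x - y) x t = u x t - u y t.
  by move=> Sx Sy xy nxy; rewrite /reflection_gap refl_sub// !UE.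
have half x y : Sigma N rad x -> enorm x = enorm y -> x != y -> half_Sigma rad (x - y) x.
  by move=> Sx xy nxy; split => //; exact: dotv_sub_gt0.
split; last first.
  move=> x y Sx Sy x00 y00 xy; rewrite polar_angle_lt// => yx.
  have nxy : x != y by apply: contraTneq yx => ->; rewrite ltxx.
  have [_ posxy] : positive_direction rad U (x - y) by apply: pos; rewrite dotvBl subr_gt0.
  by have := posxy x t (half x y Sx xy nxy) t0; rewrite gapE// subr_gt0.
split.
- apply: (@subspace_eq_continuous _ _ _ (U ^~ t)).
    by move=> x; rewrite inE => Sx; exact: UE.
  apply: continuous_subspaceT => x.
  by apply: (@cvg_uncurry _ _ U _ (nbhs x) _ id (fun=> t)) => //; exact: cvg_cst.
- move=> Q QQ pQ x Sx; have [->//|nxQ] := eqVneq (x *m Q) x.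
  have xQ : enorm x = enorm (x *m Q) by rewrite /enorm dotv_mxE.
  have SxQ : Sigma N rad (x *m Q) by apply/SigmaP; rewrite -xQ; exact/SigmaP.
  have nxQ' : x != x *m Q by rewrite eq_sym.
  (* [Q] is an isometry fixing [p], so [x] and its image are exchanged by a reflection whose normal
     is orthogonal to [p]. *)
  have E : dotv (x - x *m Q) p = 0 by rewrite dotvBl -{2}pQ dotv_mxE// subrr.
  have e0 : x - x *m Q != 0 by rewrite subr_eq0.
  by have := eq0 _ x t e0 E t0; rewrite gapE// => /eqP; rewrite subr_eq0 => /eqP.
- move=> x y Sx Sy x00 y00 xy; rewrite leNgt polar_angle_lt// -leNgt => yx.
  have [->//|nxy] := eqVneq x y.
  have := ge0 (x - y) x t; rewrite gapE// subr_ge0; apply => //.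
  + by rewrite subr_eq0.
  + by rewrite dotvBl subr_ge0.
  + exact: half.
Qed.
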